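(* Let $K$ be a field and let $\Lambda$ be a Nakayama $K$-algebra of global dimension $d$ with $2\le d<\infty$. Assume that $\Lambda$ admits a $d$-cluster tilting subcategory. Then $\Lambda=\Lambda_{m,l}$ for some $m\ge3$ and $l\ge2$.
   Context: $Q_m$ is the quiver $m\to m-1\to m-2\to\cdots\to2\to1$ and $\Lambda_{m,l}=KQ_m/(\mathrm{rad}\,KQ_m)^l$. A Nakayama algebra is either acyclic, i.e. $KQ_m/I$ for some $m$ and some admissible ideal $I$, or cyclic, i.e. $K\tilde Q/I$ where $\tilde Q$ is an oriented cycle and $I$ is an admissible ideal. $\mathrm{mod}\,\Lambda$ is the category of finitely generated right $\Lambda$-modules. A full subcategory $\mathcal{C}$ of $\mathrm{mod}\,\Lambda$ closed under direct sums and summands is an $n$-cluster tilting subcategory if it is functorially finite (every $M\in\mathrm{mod}\,\Lambda$ has a left and a right $\mathcal{C}$-approximation) and $\mathcal{C}=\{X\mid \mathrm{Ext}^i_\Lambda(\mathcal{C},X)=0 \text{ for all } 0<i<n\}=\{X\mid \mathrm{Ext}^i_\Lambda(X,\mathcal{C})=0\text{ for all }0<i<n\}$. *)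

(* Defs.v *)
From HB Require Import structures.
From mathcomp Require Import all_boot all_order all_algebra finmap monalg.

Set Implicit Arguments.
Unset Strict Implicit.
Unset Printing Implicit Defensive.

Import GRing.Theory.

Local Open Scope fset_scope.
Local Open Scope ring_scope.

(* The vertex set is nonempty because MathComp algebras are nontrivial rings. *)
Record quiver := Quiver {
  vertex : finType;
  arrow : finType;
  source : arrow -> vertex;
  target : arrow -> vertex;
  vertex_gt0 : (0 < #|vertex|)%N }.

Arguments source {q} _.
Arguments target {q} _.

Section Paths.
Variable Q : quiver.

Fixpoint composable (v : vertex Q) (s : seq (arrow Q)) : bool :=
  if s is a :: s' then (source a == v) && composable (target a) s' else true.

(* A path is its starting vertex with the arrows in the order they are        *)
(* traversed; the trivial path at v is (v, [::]).                             *)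
Record qpath : predArgType := QPath {
  qpath_val : vertex Q * seq (arrow Q);
  qpath_valP : composable qpath_val.1 qpath_val.2 }.

HB.instance Definition _ := [isSub for qpath_val].
HB.instance Definition _ := [Choice of qpath by <:].

Definition qpath_src (p : qpath) : vertex Q := (val p).1.
Definition qpath_tgt (p : qpath) : vertex Q :=
  last (val p).1 [seq target a | a <- (val p).2].

Definition trivial_path (v : vertex Q) : qpath := @QPath (v, [::]) isT.

(* Paths are multiplied in the order of traversal, so that right KQ-modules   *)
(* are representations of Q.                                                  *)
Definition qpath_cat (p q : qpath) : option qpath :=
  if qpath_tgt p == qpath_src q
  then insub (qpath_src p, (val p).2 ++ (val q).2) else None.

Lemma composable_cat v s t :
  composable v (s ++ t) =
  composable v s && composable (last v [seq target a | a <- s]) t.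
Proof. by elim: s v => //= a s IH v; rewrite IH andbA. Qed.

Lemma qpath_catP (p q : qpath) :
  qpath_tgt p = qpath_src q ->
  exists2 r, qpath_cat p q = Some r
           & val r = (qpath_src p, (val p).2 ++ (val q).2).
Proof.
move=> pq; rewrite /qpath_cat pq eqxx; case: insubP => [r _ <-|]; first by exists r.
rewrite /= composable_cat negb_and => /orP[]; first by rewrite (valP p).
by rewrite -/(qpath_tgt p) pq (valP q).
Qed.

Lemma qpath_catN (p q : qpath) :
  qpath_tgt p != qpath_src q -> qpath_cat p q = None.
Proof. by rewrite /qpath_cat => /negPf->. Qed.

Lemma qpath_catA (p q r : qpath) :
  obind (qpath_cat p) (qpath_cat q r) = obind (qpath_cat^~ r) (qpath_cat p q).
Proof.
case: (eqVneq (qpath_tgt q) (qpath_src r)) => qr; last first.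
  rewrite qpath_catN //=.
  case: (eqVneq (qpath_tgt p) (qpath_src q)) => pq; last by rewrite qpath_catN.
  have [u -> eu] := qpath_catP pq; rewrite /= qpath_catN //.
  rewrite /qpath_tgt eu /= map_cat last_cat -/(qpath_tgt p) pq.
  exact: qr.
have [w ew vw] := qpath_catP qr; rewrite ew /=.
have sw : qpath_src w = qpath_src q by rewrite {1}/qpath_src vw.
case: (eqVneq (qpath_tgt p) (qpath_src q)) => pq; last first.
  by rewrite [in RHS]qpath_catN //= qpath_catN // sw.
have [u eu vu] := qpath_catP pq; rewrite eu /=.
have pw : qpath_tgt p = qpath_src w by rewrite sw.
have ur : qpath_tgt u = qpath_src r.
  by rewrite /qpath_tgt vu /= map_cat last_cat -/(qpath_tgt p) pq.
have [x -> ex] := qpath_catP pw; have [y -> ey] := qpath_catP ur.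
by congr Some; apply: val_inj; rewrite ex ey /qpath_src vw vu /= catA.
Qed.

Lemma qpath_cat0p v (p : qpath) :
  qpath_cat (trivial_path v) p = if v == qpath_src p then Some p else None.
Proof.
case: (eqVneq v (qpath_src p)) => [vp|vp]; last by rewrite qpath_catN.
have [|r -> er] := @qpath_catP (trivial_path v) p; first exact: vp.
by congr Some; apply: val_inj; rewrite er /qpath_src /= vp; case: (p) => -[].
Qed.

Lemma qpath_catp0 v (p : qpath) :
  qpath_cat p (trivial_path v) = if v == qpath_tgt p then Some p else None.
Proof.
case: (eqVneq v (qpath_tgt p)) => [vp|vp]; last by rewrite qpath_catN // eq_sym.
have [|r -> er] := @qpath_catP p (trivial_path v); first by rewrite -vp.
by congr Some; apply: val_inj; rewrite er /qpath_src /= cats0; case: (p) => -[].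
Qed.

End Paths.

Definition path_algebra (K : fieldType) (Q : quiver) : Type :=
  {malg K[qpath Q]}.

HB.instance Definition _ (K : fieldType) (Q : quiver) :=
  GRing.Lmodule.on (path_algebra K Q).

Section PathAlgebra.
Variables (K : fieldType) (Q : quiver).
Local Notation KQ := (path_algebra K Q).
Implicit Types (x y z : KQ) (p q : qpath Q) (c : K).

Definition path_elt c p : KQ := << c *g p >>.

Definition path_eltM c p q : KQ :=
  if qpath_cat p q is Some r then path_elt c r else 0.

Definition pa_one : KQ := \sum_(v : vertex Q) path_elt 1 (trivial_path v).

Definition pa_mul x y : KQ :=
  \sum_(p <- msupp x) \sum_(q <- msupp y) path_eltM (x@_p * y@_q) p q.

Lemma path_elt0 p : path_elt 0 p = 0. Proof. exact: monalgU0. Qed.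

Lemma path_eltD p : {morph path_elt^~ p : c d / c + d}.
Proof. exact: monalgUD. Qed.

Lemma path_eltM0 p q : path_eltM 0 p q = 0.
Proof. by rewrite /path_eltM; case: qpath_cat => // r; rewrite path_elt0. Qed.

Lemma path_eltMD p q c d :
  path_eltM (c + d) p q = path_eltM c p q + path_eltM d p q.
Proof.
by rewrite /path_eltM; case: qpath_cat => [r|]; rewrite ?path_eltD ?addr0.
Qed.

Lemma path_eltMZ p q c d : path_eltM (c * d) p q = c *: path_eltM d p q.
Proof.
rewrite /path_eltM; case: qpath_cat => [r|]; last by rewrite scaler0.
by apply/malgP => k; rewrite mcoeffZ !mcoeffU mulrnAr.
Qed.

Lemma pa_mulw (d1 d2 : {fset qpath Q}) x y :
  msupp x `<=` d1 -> msupp y `<=` d2 ->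
  pa_mul x y = \sum_(p <- d1) \sum_(q <- d2) path_eltM (x@_p * y@_q) p q.
Proof.
move=> le1 le2; rewrite /pa_mul (big_fset_incl _ le1) /=; last first.
  move=> p _ /mcoeff_outdom xp.
  by rewrite big1 // => q _; rewrite xp mul0r path_eltM0.
apply/eq_bigr => p _; apply/big_fset_incl => // q _ /mcoeff_outdom ->.
by rewrite mulr0 path_eltM0.
Qed.

Lemma pa_mul0x : left_zero 0 pa_mul.
Proof. by move=> x; rewrite /pa_mul msupp0 big_seq_fset0. Qed.

Lemma pa_mulx0 : right_zero 0 pa_mul.
Proof. by move=> x; rewrite /pa_mul big1 // => p _; rewrite msupp0 big_seq_fset0. Qed.

Lemma pa_mulDl : left_distributive pa_mul +%R.
Proof.
move=> x y z.
rewrite (pa_mulw (msuppD_le x y) (fsubset_refl _)).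
rewrite (pa_mulw (fsubsetUl (msupp x) (msupp y)) (fsubset_refl _)).
rewrite (pa_mulw (fsubsetUr (msupp x) (msupp y)) (fsubset_refl _)).
rewrite -big_split; apply/eq_bigr => p _ /=.
rewrite -big_split; apply/eq_bigr => q _ /=.
by rewrite mcoeffD mulrDl path_eltMD.
Qed.

Lemma pa_mulDr : right_distributive pa_mul +%R.
Proof.
move=> x y z.
rewrite (pa_mulw (fsubset_refl _) (msuppD_le y z)).
rewrite (pa_mulw (fsubset_refl _) (fsubsetUl (msupp y) (msupp z))).
rewrite (pa_mulw (fsubset_refl _) (fsubsetUr (msupp y) (msupp z))).
rewrite -big_split; apply/eq_bigr => p _ /=.
rewrite -big_split; apply/eq_bigr => q _ /=.
by rewrite mcoeffD mulrDr path_eltMD.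
Qed.

Lemma pa_mulUU c d p q :
  pa_mul (path_elt c p) (path_elt d q) = path_eltM (c * d) p q.
Proof. by rewrite (pa_mulw msuppU_le msuppU_le) !big_seq_fset1 !mcoeffUU. Qed.

Lemma pa_expand x : x = \sum_(p <- msupp x) path_elt x@_p p.
Proof. exact: monalgE. Qed.

Lemma pa_mul_suml I (r : seq I) (F : I -> KQ) y :
  pa_mul (\sum_(i <- r) F i) y = \sum_(i <- r) pa_mul (F i) y.
Proof. exact: (big_morph (pa_mul^~ y) (fun _ _ => pa_mulDl _ _ _) (pa_mul0x y)). Qed.

Lemma pa_mul_sumr I (r : seq I) (F : I -> KQ) y :
  pa_mul y (\sum_(i <- r) F i) = \sum_(i <- r) pa_mul y (F i).
Proof. exact: (big_morph (pa_mul y) (fun _ _ => pa_mulDr _ _ _) (pa_mulx0 y)). Qed.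

Lemma pa_mulA : associative pa_mul.
Proof.
move=> x y z; rewrite (pa_expand x) !pa_mul_suml; apply/eq_bigr => p _.
rewrite (pa_expand y) pa_mul_suml !pa_mul_sumr pa_mul_suml.
apply/eq_bigr => q _.
rewrite (pa_expand z) !pa_mul_sumr; apply/eq_bigr => r _.
rewrite !pa_mulUU; have := qpath_catA p q r.
rewrite /path_eltM; case: (qpath_cat q r) => [u|]; case: (qpath_cat p q) => [w|] /=.
- by rewrite !pa_mulUU /path_eltM mulrA => ->.
- by rewrite pa_mulUU /path_eltM pa_mul0x => ->.
- by rewrite pa_mulUU /path_eltM pa_mulx0 => <-.
- by rewrite pa_mulx0 pa_mul0x.
Qed.

Lemma pa_mul1x : left_id pa_one pa_mul.
Proof.
move=> x; rewrite [in LHS](pa_expand x) [RHS]pa_expand pa_mul_sumr.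
apply/eq_bigr => p _; rewrite /pa_one pa_mul_suml.
rewrite (bigD1 (qpath_src p)) //= big1 ?addr0 => [|v vp].
  by rewrite pa_mulUU /path_eltM qpath_cat0p eqxx mul1r.
by rewrite pa_mulUU /path_eltM qpath_cat0p (negPf vp).
Qed.

Lemma pa_mulx1 : right_id pa_one pa_mul.
Proof.
move=> x; rewrite [in LHS](pa_expand x) [RHS]pa_expand pa_mul_suml.
apply/eq_bigr => p _; rewrite /pa_one pa_mul_sumr.
rewrite (bigD1 (qpath_tgt p)) //= big1 ?addr0 => [|v vp].
  by rewrite pa_mulUU /path_eltM qpath_catp0 eqxx mulr1.
by rewrite pa_mulUU /path_eltM qpath_catp0 (negPf vp).
Qed.

Lemma pa_one_neq0 : pa_one != 0.
Proof.
have /card_gt0P[v _] := vertex_gt0 Q.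
apply/eqP => /(congr1 (mcoeff (trivial_path v)))/eqP.
rewrite /pa_one raddf_sum mcoeff0 (bigD1 v) //= big1 ?addr0 => [|w wv].
  by rewrite mcoeffUU oner_eq0.
by rewrite mcoeffU -val_eqE /= xpair_eqE (negPf wv).
Qed.

HB.instance Definition _ := GRing.Zmodule_isNzRing.Build KQ
  pa_mulA pa_mul1x pa_mulx1 pa_mulDl pa_mulDr pa_one_neq0.

Lemma pa_scaleAl (c : K) (x y : KQ) : c *: (x * y) = (c *: x) * y.
Proof.
rewrite -[(c *: x) * y]/(pa_mul _ _) (pa_mulw (msuppZ_le c x) (fsubset_refl _)).
rewrite -[x * y]/(pa_mul _ _) /pa_mul scaler_sumr.
apply/eq_bigr => p _; rewrite scaler_sumr; apply/eq_bigr => q _.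
by rewrite mcoeffZ -mulrA (path_eltMZ p q c).
Qed.

HB.instance Definition _ := GRing.Lmodule_isLalgebra.Build K KQ pa_scaleAl.

Lemma pa_scaleAr (c : K) (x y : KQ) : c *: (x * y) = x * (c *: y).
Proof.
rewrite -[x * (c *: y)]/(pa_mul _ _) (pa_mulw (fsubset_refl _) (msuppZ_le c y)).
rewrite -[x * y]/(pa_mul _ _) /pa_mul scaler_sumr.
apply/eq_bigr => p _; rewrite scaler_sumr; apply/eq_bigr => q _.
by rewrite mcoeffZ mulrCA (path_eltMZ p q c).
Qed.

HB.instance Definition _ := GRing.Lalgebra_isAlgebra.Build K KQ pa_scaleAr.

End PathAlgebra.

Section Ideals.
Variable A : nzRingType.
Implicit Types (I J S : A -> Prop).

Definition right_ideal I : Prop :=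
  [/\ I 0, forall x y, I x -> I y -> I (x + y) & forall x a, I x -> I (x * a)].

Definition ideal I : Prop := right_ideal I /\ forall a x, I x -> I (a * x).

Definition ideal_gen S : A -> Prop :=
  fun x => forall I, ideal I -> (forall y, S y -> I y) -> I x.

Definition ideal_mul I J : A -> Prop := fun x =>
  exists2 s : seq (A * A), (forall u, u \in s -> I u.1 /\ J u.2)
                         & x = \sum_(u <- s) u.1 * u.2.

Fixpoint ideal_exp I (n : nat) : A -> Prop :=
  if n is n'.+1 then ideal_mul (ideal_exp I n') I else fun=> True.

Definition maximal_right_ideal I : Prop :=
  [/\ right_ideal I, ~ I 1 &
      forall J, right_ideal J -> ~ J 1 -> (forall x, I x -> J x) ->
                forall x, J x -> I x].

Definition jacobson_radical : A -> Prop :=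
  fun x => forall I, maximal_right_ideal I -> I x.

End Ideals.

(* L is isomorphic to A / I as a K-algebra, stated through the canonical      *)
(* surjection A -> A / I.                                                     *)
Definition is_quotient (K : fieldType) (A : algType K) (I : A -> Prop)
    (L : algType K) : Prop :=
  exists f : {lrmorphism A -> L},
    (forall y, exists x, f x = y) /\ (forall x, f x = 0 <-> I x).

Definition arrow_ideal (K : fieldType) (Q : quiver) : path_algebra K Q -> Prop :=
  ideal_gen (fun x : path_algebra K Q =>
    exists2 p : qpath Q, size (val p).2 = 1%N & x = path_elt 1 p).

Definition admissible (K : fieldType) (Q : quiver)
    (I : path_algebra K Q -> Prop) : Prop :=
  [/\ ideal I,
      forall x, I x -> ideal_exp (@arrow_ideal K Q) 2 x &
      exists2 t, (2 <= t)%N & forall x, ideal_exp (@arrow_ideal K Q) t x -> I x].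

(* Q_m : m -> m-1 -> ... -> 1, meaningful for m > 0; the ordinal k stands for *)
(* the vertex k+1, and the arrow k goes from the ordinal k+1 to the ordinal k. *)
Lemma linear_vertex_gt0 m : (0 < #|'I_m.-1.+1|)%N. Proof. by rewrite card_ord. Qed.

Definition linear_quiver (m : nat) : quiver :=
  @Quiver 'I_m.-1.+1 'I_m.-1
    (fun a => lift ord0 a) (fun a => widen_ord (leqnSn _) a)
    (linear_vertex_gt0 m).

(* The oriented cycle with n.+1 vertices; n = 0 is the loop.                  *)
Lemma cyclic_vertex_gt0 n : (0 < #|'I_n.+1|)%N. Proof. by rewrite card_ord. Qed.

Definition cyclic_quiver (n : nat) : quiver :=
  @Quiver 'I_n.+1 'I_n.+1 (fun a => a) (fun a => ordS a) (cyclic_vertex_gt0 n).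

Definition acyclic_nakayama (K : fieldType) (L : algType K) : Prop :=
  exists2 m, (0 < m)%N &
    exists2 I : path_algebra K (linear_quiver m) -> Prop,
      admissible I & is_quotient I L.

Definition cyclic_nakayama (K : fieldType) (L : algType K) : Prop :=
  exists n, exists2 I : path_algebra K (cyclic_quiver n) -> Prop,
    admissible I & is_quotient I L.

Definition nakayama (K : fieldType) (L : algType K) : Prop :=
  acyclic_nakayama L \/ cyclic_nakayama L.

Definition is_Lambda (K : fieldType) (m l : nat) (L : algType K) : Prop :=
  is_quotient (ideal_exp (@jacobson_radical (path_algebra K (linear_quiver m))) l) L.

(* MathComp modules are left modules; a right A-module is a left module over  *)
(* the opposite ring A^c, with x . a written (a : A^c) *: x.                  *)
Notation rmodType A := (lmodType A^c).

Section Modules.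
Variable A : nzRingType.
Implicit Types M N P X Y : rmodType A.

Definition finitely_generated M : Prop :=
  exists n (g : 'I_n -> M), forall x, exists c : 'I_n -> A^c,
    x = \sum_(i < n) c i *: g i.

Definition mod_iso M N : Prop := exists f : {linear M -> N}, bijective f.

Definition projective P : Prop :=
  forall (M N : rmodType A) (g : {linear M -> N}) (f : {linear P -> N}),
    (forall y, exists x, g x = y) ->
    exists h : {linear P -> M}, forall x, g (h x) = f x.

Record projective_resolution M := ProjectiveResolution {
  res_term : nat -> rmodType A;
  res_diff : forall i, {linear res_term i.+1 -> res_term i};
  res_aug : {linear res_term 0%N -> M};
  res_proj : forall i, projective (res_term i);
  res_aug_surj : forall y, exists x, res_aug x = y;
  res_exact0 : forall x, res_aug x = 0 <-> exists y, res_diff 0 y = x;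
  res_exact : forall i x, res_diff i x = 0 <-> exists y, res_diff i.+1 y = x }.

(* H^i(Hom(R, N)) = 0; for i = 0 the cohomology is just a kernel.             *)
Definition Hom_acyclic_at M (R : projective_resolution M) N (i : nat) : Prop :=
  match i with
  | 0 => forall f : {linear res_term R 0%N -> N},
           (forall x, f (res_diff R 0 x) = 0) -> forall x, f x = 0
  | j.+1 => forall f : {linear res_term R j.+1 -> N},
           (forall x, f (res_diff R j.+1 x) = 0) ->
           exists g : {linear res_term R j -> N},
             forall x, f x = g (res_diff R j x)
  end.

(* Ext^i(M, N) = 0; the cohomology does not depend on the resolution. *)
Definition Ext_eq0 (i : nat) M N : Prop :=
  exists R : projective_resolution M, Hom_acyclic_at R N i.

Definition projdim_le M (n : nat) : Prop :=
  exists R : projective_resolution M,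
    forall i, (n < i)%N -> forall x : res_term R i, x = 0.

End Modules.

Definition gldim_le (A : nzRingType) (n : nat) : Prop :=
  forall M : rmodType A, finitely_generated M -> projdim_le M n.

Definition gldim_eq (A : nzRingType) (d : nat) : Prop :=
  gldim_le A d /\ forall n, gldim_le A n -> (d <= n)%N.

Section ClusterTilting.
Variable A : nzRingType.
Implicit Types (C : rmodType A -> Prop) (M X Y : rmodType A).

Definition right_approximation C M : Prop :=
  exists (X : rmodType A) (f : {linear X -> M}), C X /\
    forall (Y : rmodType A) (g : {linear Y -> M}), C Y ->
      exists h : {linear Y -> X}, forall y, g y = f (h y).

Definition left_approximation C M : Prop :=
  exists (X : rmodType A) (f : {linear M -> X}), C X /\
    forall (Y : rmodType A) (g : {linear M -> Y}), C Y ->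
      exists h : {linear X -> Y}, forall x, g x = h (f x).

Definition functorially_finite C : Prop :=
  forall M, finitely_generated M ->
    right_approximation C M /\ left_approximation C M.

(* A full subcategory of mod A is given by its class of objects. *)
Record cluster_tilting (n : nat) C : Prop := ClusterTilting {
  ct_fg : forall M, C M -> finitely_generated M;
  ct_sum : forall X Y, C X -> C Y -> C (X * Y)%type;
  ct_summand : forall M X Y, C M -> mod_iso M (X * Y)%type -> C X;
  ct_functorially_finite : functorially_finite C;
  ct_right : forall X, C X <-> finitely_generated X /\
    forall Y, C Y -> forall i, (0 < i < n)%N -> Ext_eq0 i Y X;
  ct_left : forall X, C X <-> finitely_generated X /\
    forall Y, C Y -> forall i, (0 < i < n)%N -> Ext_eq0 i X Y }.

End ClusterTilting.

(* Main.v *)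
(** A Nakayama algebra is encoded by its Kupisch function [p]: unrolling the
   quiver to positions in [nat], the projective at [u] is the interval
   [[u, p u)], every interval [[a, b)] with [a <= b <= p a] is a module, and its
   i-th syzygy is [[x_i, x_(i+1))] where [x_0 = a], [x_1 = b] and
   [x_(i+2) = p x_i]. A [d]-cluster tilting subcategory contains the projectives
   and the injectives, so Ext^i(I, P) = 0 for I injective, P projective and
   0 < i < d. Combinatorially, if [[a, b)] is injective and not projective, then
   [x_0 < ... < x_(d+1)] and [p (x_i).+1 > p x_i] for [i <= d - 2].
   If [p] jumped by at least 2 at a position having a predecessor [a], comparing
   the syzygies of the simple module at [a] with those of such an injective would
   give that simple module projective dimension larger than [d]. Hence [p] never
   jumps. In the cyclic case [p u = u + l] then holds by periodicity, and the
   global dimension is infinite; in the linear case the same two constraints,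
   applied at the first [s] with [p s.+1 = p s], force [p s] to be the end of the
   quiver, that is [p u = min (u + l) m]. *)
From HB Require Import structures.
From mathcomp Require Import all_boot all_order all_algebra finmap monalg.
From mathcomp Require Import zify boolp classical_sets.
Require Import Defs.
Set Implicit Arguments. Unset Strict Implicit. Unset Printing Implicit Defensive.
Import GRing.Theory.
Local Open Scope ring_scope.

(** * Lifting maps out of projective modules *)

Definition linear_of (R : pzRingType) (U V : lmodType R) (f : U -> V)
  (lf : linear f) : {linear U -> V} :=
  HB.pack f (GRing.isLinear.Build _ _ _ _ f lf).

Section Range.
Variables (R : nzRingType) (M N : lmodType R) (g : {linear M -> N}).

Definition in_range : pred N := fun x => `[< exists y, g y = x >].

Lemma in_range_submod : submod_closed in_range.
Proof.
split; first by apply/asboolP; exists 0; rewrite linear0.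
move=> a _ _ /asboolP[x <-] /asboolP[y <-].
by apply/asboolP; exists (a *: x + y); rewrite linearP.
Qed.

HB.instance Definition _ := GRing.isSubmodClosed.Build R N in_range
  (GRing.submod_closed_semi in_range_submod).

Record range_mod : predArgType := RangeMod { range_val : N; _ : in_range range_val }.
HB.instance Definition _ := [isSub for range_val].
HB.instance Definition _ := [Choice of range_mod by <:].
HB.instance Definition _ := [SubChoice_isSubLmodule of range_mod by <:].
End Range.

(** [projective] lifts along surjections, so [f] and [g] are first corestricted to the range of
    [g]. *)
Lemma projective_lift (A : nzRingType) (P M N : rmodType A) (f : {linear P -> N})
    (g : {linear M -> N}) :
  projective P -> (forall x, exists y, g y = f x) ->
  exists h : {linear P -> M}, forall x, g (h x) = f x.
Proof.
move=> projP fg.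
have fP x : in_range g (f x) by apply/asboolP.
have gP y : in_range g (g y) by apply/asboolP; exists y.
have fL : linear (fun x => RangeMod (fP x)).
  by move=> a u v; apply: val_inj; rewrite /= linearP.
have gL : linear (fun y => RangeMod (gP y)).
  by move=> a u v; apply: val_inj; rewrite /= linearP.
have [|h hP] := projP _ _ (linear_of gL) (linear_of fL).
  case=> z zP; have /asboolP[y yz] := zP.
  by exists y; apply: val_inj; rewrite /= yz.
by exists h => x; have /(congr1 val) := hP x.
Qed.

(** * Comparison of projective resolutions *)

Section Comparison.
Variables (A : nzRingType) (M : rmodType A).
Implicit Types R S : projective_resolution M.

Lemma res_diffK S i x : res_diff S i (res_diff S i.+1 x) = 0.
Proof. by apply/res_exact; exists x. Qed.

Lemma res_augK S x : res_aug S (res_diff S 0 x) = 0.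
Proof. by apply/res_exact0; exists x. Qed.

Definition chain_square R S i
    (f : {linear res_term R i -> res_term S i} *
         {linear res_term R i.+1 -> res_term S i.+1}) :=
  forall x, res_diff S i (f.2 x) = f.1 (res_diff R i x).

(** Lifting to the next degree needs the square just built to commute, so the recursion carries two
    consecutive components together with a proof of [chain_square]. *)
Lemma chain_map_exists R S :
  exists f : forall i, {linear res_term R i -> res_term S i},
    (forall x, res_aug S (f 0%N x) = res_aug R x) /\
    forall i x, res_diff S i (f i.+1 x) = f i (res_diff R i x).
Proof.
have [f0 f0P] : exists h : {linear res_term R 0 -> res_term S 0},
    forall x, res_aug S (h x) = res_aug R x.
  apply: projective_lift => [|x]; first exact: res_proj.
  exact: res_aug_surj.
have [f1 f1P] : exists h : {linear res_term R 1 -> res_term S 1},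
    forall x, res_diff S 0 (h x) = (f0 \o res_diff R 0) x.
  apply: projective_lift => [|x]; first exact: res_proj.
  by apply/res_exact0; rewrite /= f0P res_augK.
have step i (u : {f | @chain_square R S i f}) :
    exists g, @chain_square R S i.+1 ((sval u).2, g).
  case: u => -[f g] /= fgP.
  apply: (@projective_lift _ _ _ _ (g \o res_diff R i.+1)) => [|x].
    exact: res_proj.
  by apply/res_exact; rewrite /= (fgP _) res_diffK linear0.
pose next i u : {f | @chain_square R S i.+1 f} :=
  exist _ ((sval u).2, sval (cid (step i u))) (svalP (cid (step i u))).
pose F := nat_rect (fun i => {f | @chain_square R S i f})
  (exist _ (f0, f1) f1P) next.
by exists (fun i => (sval (F i)).1); split=> // i x; apply: (svalP (F i)).
Qed.

(** A chain endomorphism over the identity of [M] is homotopic to the identity. Two consecutive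
    components of the homotopy suffice to compare cohomology in one degree. *)
Lemma homotopy_to_id S (f : forall i, {linear res_term S i -> res_term S i}) i :
  (forall x, res_aug S (f 0%N x) = res_aug S x) ->
  (forall j x, res_diff S j (f j.+1 x) = f j (res_diff S j x)) ->
  exists (h : {linear res_term S i -> res_term S i.+1})
         (h' : {linear res_term S i.+1 -> res_term S i.+2}),
    forall x, f i.+1 x = x + (res_diff S i.+1 (h' x) + h (res_diff S i x)).
Proof.
move=> f0 fS.
have step j (h : {linear res_term S j -> res_term S j.+1}) :
    (forall x, res_diff S j (f j.+1 x - x - h (res_diff S j x)) = 0) ->
    exists h' : {linear res_term S j.+1 -> res_term S j.+2},
      forall x, f j.+1 x = x + (res_diff S j.+1 (h' x) + h (res_diff S j x)).
  move=> h0; pose g := f j.+1 \- idfun \- (h \o res_diff S j).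
  have [|x|h' h'P] := @projective_lift _ _ _ _ g (res_diff S j.+1).
  - exact: res_proj.
  - exact/res_exact/h0.
  by exists h' => x; rewrite h'P /= subrK addrC subrK.
elim: i => [|i [h [h' IH]]].
  have [|x|h hP] := @projective_lift _ _ _ _ (f 0%N \- idfun) (res_diff S 0).
  - exact: res_proj.
  - by apply/res_exact0; rewrite /= linearB /= f0 subrr.
  exists h; apply: step => x.
  by rewrite !linearB /= fS hP /= subrr.
exists h'; apply: step => x; rewrite !linearB /= fS IH res_diffK linear0 addr0.
by rewrite addrAC addrK subrr.
Qed.

(** A cocycle [f] on [S] pulls back along [u] to a coboundary on [R], given by [g]. Pulling back
    further along [v] recovers [f] up to the homotopy term [f \o h], which is a coboundary as
    well. *)
Lemma Hom_acyclic_indep R S N i :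
  Hom_acyclic_at R N i.+1 -> Hom_acyclic_at S N i.+1.
Proof.
have [u [u0 uS]] := chain_map_exists R S.
have [v [v0 vS]] := chain_map_exists S R.
move=> acR f fd.
have [x|g gP] := acR (f \o u i.+1); first by rewrite /= -uS fd.
pose w j : {linear res_term S j -> res_term S j} := u j \o v j.
have [x|j x|h [h' hP]] := @homotopy_to_id S w i.
- by rewrite /w /= u0 v0.
- by rewrite /w /= uS vS.
exists ((g \o v i) \- (f \o h)) => x /=.
have := congr1 f (hP x); rewrite /= !linearD /= fd add0r => fhP.
by rewrite -vS -gP /= fhP addrK.
Qed.

End Comparison.

(** * Linear algebra in arbitrary dimension *)

Section Complement.
Variables (K : fieldType).

Definition lin_closed (V : lmodType K) (U : V -> Prop) :=
  U 0 /\ forall a u v, U u -> U v -> U (a *: u + v).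

Lemma lin_closedB (V : lmodType K) (U : V -> Prop) u v :
  lin_closed U -> U u -> U v -> U (u - v).
Proof. by move=> [_ cl] Uu Uv; rewrite addrC -scaleN1r; apply: cl. Qed.

(** By Zorn, take a maximal subspace meeting [U] trivially; a vector [x] outside its sum with [U]
    could be adjoined to it. *)
Lemma complement_exists (V : lmodType K) (U : V -> Prop) : lin_closed U ->
  exists W : V -> Prop, [/\ lin_closed W, forall x, U x -> W x -> x = 0 &
    forall x, exists2 u, U u & W (x - u)].
Proof.
move=> [U0 Ucl].
(* [W] ranges over the nonzero parts of subspaces, so that the union of the   *)
(* empty chain is admissible.                                                 *)
pose sp (W : set V) := fun x => x = 0 \/ W x.
pose P (W : set V) := (forall a u v, sp W u -> sp W v -> sp W (a *: u + v)) /\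
  forall x, U x -> W x -> x = 0.
have [F FP Ftot|W [[Wcl WU] Wmax]] := @Zorn_bigcup V P.
  split=> [a u v|x Ux [W FW Wx]]; last exact: (FP _ FW).2 Wx.
  case=> [->|[W FW Wu]] [->|[W' FW' Wv]].
  - by left; rewrite scaler0 addr0.
  - by right; exists W' => //; rewrite scaler0 add0r.
  - have [-> |Wx] := (FP _ FW).1 a u 0 (or_intror Wu) (or_introl erefl).
      by left.
    by right; exists W.
  - have [Z [FZ Zu Zv]] : exists Z, [/\ F Z, Z u & Z v].
      by have [s|s] := Ftot _ _ FW FW'; [exists W'|exists W]; split=> //; apply: s.
    have [->|Zx] := (FP _ FZ).1 a u v (or_intror Zu) (or_intror Zv).
      by left.
    by right; exists Z.
exists (sp W); split=> [|x Ux [//|Wx]|x]; first by split; [left|].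
  exact: WU.
apply: contrapT => xN.
pose W' : set V := fun y => W y \/ exists a u, a != 0 /\ sp W u /\ y = a *: x + u.
have W'x : W' x by right; exists 1, 0; rewrite oner_eq0 scale1r addr0; do !split; left.
have spW' y : sp W' y <-> exists a u, sp W u /\ y = a *: x + u.
  split=> [[->|[Wy|[a [u [_ [Wu ->]]]]]]|[a [u [Wu ->]]]].
  - by exists 0, 0; rewrite scale0r addr0; split=> //; left.
  - by exists 0, y; rewrite scale0r add0r; split=> //; right.
  - by exists a, u.
  - have [->|aN0] := eqVneq a 0; last by right; right; exists a, u.
    by rewrite scale0r add0r; case: Wu; [left|right; left].
apply: (Wmax W'); last split.
- split=> [|sub]; first by move=> y Wy; left.
  apply: xN; exists 0 => //; rewrite subr0; right; exact: sub.
- move=> a _ _ /spW'[b [u [Wu ->]]] /spW'[c [v [Wv ->]]]; apply/spW'.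
  exists (a * b + c), (a *: u + v); split; first exact: Wcl.
  by rewrite scalerDr scalerA scalerDl addrACA.
- move=> y Uy [Wy|[a [u [aN0 [Wu yE]]]]]; first exact: WU.
  case: xN; exists (a^-1 *: y + 0); first exact: Ucl.
  have -> : x - (a^-1 *: y + 0) = - a^-1 *: u + 0.
    rewrite !addr0 yE scalerDr scalerA mulVf // scale1r opprD addrA subrr add0r.
    by rewrite scaleNr.
  by apply: Wcl => //; left.
Qed.

(** Project [Y] onto the range of [f] along a complement, then invert [f] on a complement [V] of its
    kernel. *)
Lemma linear_ginv (X Y : lmodType K) (f : {linear X -> Y}) :
  exists s : {linear Y -> X}, forall x, f (s (f x)) = f x.
Proof.
have [|V [Vlin VI VD]] := @complement_exists X (fun x => f x = 0).
  by split=> [|a u v fu fv]; rewrite ?linear0 // linearP fu fv scaler0 addr0.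
have [|W [Wlin WI WD]] := @complement_exists Y (fun y => exists x, f x = y).
  split=> [|a _ _ [u <-] [v <-]]; first by exists 0; rewrite linear0.
  by exists (a *: u + v); rewrite linearP.
have sP y : exists x, V x /\ W (y - f x).
  have [_ [x <-] Wx] := WD y; have [u u0 Vu] := VD x.
  by exists (x - u); split=> //; rewrite linearB /= u0 subr0.
have sU x x' y : V x -> W (y - f x) -> V x' -> W (y - f x') -> x = x'.
  move=> Vx Wx Vx' Wx'; apply/subr0_eq/VI; last exact: lin_closedB.
  apply: WI; first by eexists.
  have := lin_closedB Wlin Wx' Wx.
  by rewrite opprB addrC addrA subrK -linearB.
have /choice[s sP'] := sP.
have sl : linear s.
  move=> a u v; have [[_ Vcl] [_ Wcl]] := (Vlin, Wlin).
  have [[Vu Wu] [Vv Wv]] := (sP' u, sP' v).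
  have [Vx Wx] := sP' (a *: u + v).
  apply: (sU _ _ (a *: u + v)) => //; first exact: Vcl.
  by have := Wcl a _ _ Wu Wv; rewrite linearP /= scalerBr opprD addrACA.
exists (linear_of sl) => x /=; have [Vs Ws] := sP' (f x).
by apply/esym/subr0_eq/WI => //; exists (x - s (f x)); rewrite linearB.
Qed.
End Complement.

(** An alias, so that the underlying vector space over [K] and the module over [L^c] have separate
    scalings. *)
Definition scalar_restriction (K : fieldType) (L : algType K) (M : rmodType L) : Type := M.

Section ScalarRestriction.
Variables (K : fieldType) (L : algType K) (M : rmodType L).
Local Notation M' := (scalar_restriction M).
HB.instance Definition _ := GRing.Zmodule.on M'.

Definition restr_scale (c : K) (x : M') : M' := (c%:A : L^c) *: (x : M).
Lemma restr_scaleA a b v : restr_scale a (restr_scale b v) = restr_scale (a * b) v.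
Proof.
rewrite /restr_scale scalerA; congr (_ *: _).
change ((b%:A : L) * a%:A = (a * b)%:A).
by rewrite -scalerAl mul1r scalerA mulrC.
Qed.
Lemma restr_scale1 : left_id 1 restr_scale.
Proof. by move=> x; rewrite /restr_scale scale1r; apply: scale1r. Qed.
Lemma restr_scaleDr : right_distributive restr_scale +%R.
Proof. by move=> c x y; apply: scalerDr. Qed.
Lemma restr_scaleDl v : {morph restr_scale^~ v : a b / a + b}.
Proof. by move=> a b; rewrite /restr_scale !scalerDl. Qed.
HB.instance Definition _ := GRing.Zmodule_isLmodule.Build K M'
  restr_scaleA restr_scale1 restr_scaleDr restr_scaleDl.
End ScalarRestriction.

Lemma linear_restr (K : fieldType) (L : algType K) (M N : rmodType L)
    (f : {linear M -> N}) :
  linear (f : scalar_restriction M -> scalar_restriction N).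
Proof. by move=> a u v; rewrite [LHS]linearP. Qed.

(** * Interval modules on the universal cover *)

Lemma big_nat_restrict (V : nmodType) (F : nat -> V) a b c d :
  (a <= c)%N -> (d <= b)%N ->
  (forall i, (a <= i < b)%N -> ~~ (c <= i < d)%N -> F i = 0) ->
  \sum_(a <= i < b) F i = \sum_(c <= i < d) F i.
Proof.
move=> ac db F0; have [dc|cd] := leqP d c.
  rewrite [RHS]big_geq // big_nat_cond big1 // => i /andP[/F0 + _]; apply.
  by apply/negP => /andP[ci id']; have := leq_trans (leq_trans id' dc) ci; rewrite ltnn.
have acZ : \sum_(a <= i < c) F i = 0.
  rewrite big_nat_cond big1 // => i /andP[/andP[ai ic] _].
  rewrite F0 ?ai //=; last by rewrite leqNgt ic.
  exact: leq_trans (ltn_trans ic cd) db.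
have dbZ : \sum_(d <= i < b) F i = 0.
  rewrite big_nat_cond big1 // => i /andP[/andP[di ib] _].
  rewrite F0 ?ib ?andbT //; last by rewrite ltnNge di andbF.
  exact: leq_trans ac (leq_trans (ltnW cd) di).
rewrite (@big_cat_nat _ _ _ c) //=; last exact: leq_trans (ltnW cd) db.
by rewrite (@big_cat_nat _ _ _ d c b) //= ?(ltnW cd) // acZ dbZ add0r addr0.
Qed.

(* The universal cover of a Nakayama algebra: positions are natural numbers,  *)
(* [nd_path u w] is the path from position [u] to position [w], and           *)
(* [nd_coef u w] the coefficient at that path; the nonzero paths from [u] are *)
(* those with [u <= w < nd_p u]. Modules are intervals of positions, the      *)
(* projectives being [[u, nd_p u)]; positions with [nd_p u = u] are void.     *)
(* [nd_start] tells that position 0 has no predecessor.                       *)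
Record nakayama_data (K : fieldType) (L : algType K) := NakayamaData {
  nd_p : nat -> nat;
  nd_coef : nat -> nat -> {scalar L};
  nd_path : nat -> nat -> L;
  nd_start : bool;
  nd_inj := fun a b => [&& (a < b)%N, (b <= nd_p a)%N
                         & if a is a'.+1 then (nd_p a' < b)%N else nd_start];
  nd_p_ge : forall u, (u <= nd_p u)%N;
  nd_p_mono : forall u v, (u <= v)%N -> (nd_p u <= nd_p v)%N;
  nd_coef_low : forall j w y, (w < j)%N -> nd_coef j w y = 0;
  nd_coef1 : forall j w, (j <= w < nd_p j)%N -> nd_coef j w 1 = (j == w)%:R;
  nd_coefM : forall j w y z, (w < nd_p j)%N ->
    nd_coef j w (y * z) = \sum_(j <= i < w.+1) nd_coef j i y * nd_coef i w z;
  nd_coef_col : forall j u w, (j <= w < nd_p j)%N -> (u <= w)%N ->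
    nd_coef j w (nd_path u w) = (j == u)%:R;
  nd_coef_row : forall u w w', (u <= w < nd_p u)%N -> (u <= w' < nd_p u)%N ->
    nd_coef u w (nd_path u w') = (w == w')%:R;
  nd_row : forall u y, nd_path u u * y =
    \sum_(u <= w < nd_p u) nd_coef u w y *: nd_path u w;
  nd_col : forall a b w y, nd_inj a b -> (a <= w < b)%N ->
    y * nd_path w b.-1 = \sum_(a <= j < b) nd_coef j w y *: nd_path j b.-1 }.

Section IntervalVectors.
Variables (K : fieldType) (a b : nat).
Definition ivec := {ffun 'I_(b - a) -> K}.
Implicit Types v : ivec.

(** Coordinates are read at absolute positions and vanish outside [[a, b)], so vectors on different
    intervals can be compared. *)
Definition iat v (j : nat) : K :=
  if (a <= j)%N then oapp v 0 (insub (j - a)%N) else 0.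
Definition ivec_of (f : nat -> K) : ivec := [ffun i : 'I_(b - a) => f (a + i)%N].

Lemma iat_out v j : ~~ (a <= j < b)%N -> iat v j = 0.
Proof.
rewrite /iat; case: (leqP a j) => //= aj; rewrite -leqNgt => bj.
by case: insubP => // i; rewrite ltnNge leq_sub2r.
Qed.

Lemma iat_of f j : iat (ivec_of f) j = if (a <= j < b)%N then f j else 0.
Proof.
case: ifP => [/andP[aj jb]|/negbT/iat_out //]; rewrite /iat aj.
have jab : (j - a < b - a)%N by rewrite ltn_sub2rE.
by rewrite insubT /= ffunE /= subnKC.
Qed.

Lemma iatE v j (jab : (j < b - a)%N) : iat v (a + j) = v (Ordinal jab).
Proof. by rewrite /iat leq_addr addKn insubT. Qed.

Lemma iat_ext v v' : (forall j, (a <= j < b)%N -> iat v j = iat v' j) -> v = v'.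
Proof.
move=> vv; apply/ffunP => -[j jab]; rewrite -!iatE; apply: vv.
by rewrite leq_addr -ltn_subRL.
Qed.

Lemma iat0 j : iat 0 j = 0.
Proof. by rewrite /iat; case: ifP => // _; case: insub => //= i; rewrite ffunE. Qed.

Lemma iatD v v' j : iat (v + v') j = iat v j + iat v' j.
Proof.
rewrite /iat; case: ifP => _; last by rewrite addr0.
by case: insub => [i|] /=; rewrite ?ffunE ?addr0.
Qed.
End IntervalVectors.
Arguments ivec_of {K} a b f.

Section IntervalModule.
Variables (K : fieldType) (L : algType K) (D : nakayama_data L).
Local Notation p := (nd_p D).
Local Notation coef := (nd_coef D).
Local Notation path := (nd_path D).

Lemma coefM_wide a b j w y z : (a <= j)%N -> (w < b)%N -> (w < p j)%N ->
  coef j w (y * z) = \sum_(a <= i < b) coef j i y * coef i w z.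
Proof.
move=> aj wb wp; rewrite nd_coefM //; apply/esym/big_nat_restrict => // i _.
by rewrite ltnS negb_and -!ltnNge => /orP[]/nd_coef_low->; rewrite ?mul0r ?mulr0.
Qed.

(** The proof [bp] is part of the type because the action of [L] is associative and unital under
    this bound. An element of [L] acts on row vectors through the triangular matrix of its
    coefficients. *)
Definition imod (a b : nat) (bp : (b <= p a)%N) : Type := ivec K a b.

Section Structure.
Variables (a b : nat) (bp : (b <= p a)%N).
HB.instance Definition _ := GRing.Zmodule.on (imod bp).

Definition imod_scale (y : L^c) (v : imod bp) : imod bp :=
  ivec_of a b (fun w => \sum_(a <= j < b) iat v j * coef j w y).

Lemma imod_p j w : (a <= j)%N -> (w < b)%N -> (w < p j)%N.
Proof. by move=> aj wb; apply: leq_trans wb (leq_trans bp (nd_p_mono _ aj)). Qed.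

Lemma imod_scaleA x y v : imod_scale x (imod_scale y v) = imod_scale (x * y) v.
Proof.
apply: iat_ext => w /[dup] wab /andP[aw wb]; rewrite !iat_of wab.
under eq_big_nat => i iab do rewrite iat_of iab mulr_suml.
rewrite exchange_big_nat /=; apply: eq_big_nat => j /andP[aj jb].
under eq_bigr do rewrite -mulrA.
rewrite -mulr_sumr; congr (_ * _).
by rewrite -[(x * y)%R]/((y : L) * x) (@coefM_wide a b) // (imod_p aj).
Qed.

Lemma imod_scale1 : left_id 1 imod_scale.
Proof.
move=> v; apply: iat_ext => w /[dup] wab /andP[aw wb]; rewrite iat_of wab.
rewrite (@big_nat_restrict _ _ a b w w.+1) // ?big_nat1.
  by rewrite nd_coef1 ?eqxx ?mulr1 // leqnn (imod_p aw).
move=> j /andP[aj jb]; rewrite ltnS -eqn_leq => wj.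
have [jw|wj'] := leqP j w; last by rewrite nd_coef_low ?mulr0.
by rewrite nd_coef1 ?jw ?(imod_p aj) // eq_sym (negPf wj) mulr0.
Qed.

Lemma imod_scaleDr : right_distributive imod_scale +%R.
Proof.
move=> y u v; apply: iat_ext => w wab; rewrite iatD !iat_of wab -big_split /=.
by apply: eq_bigr => j _; rewrite iatD mulrDl.
Qed.

Lemma imod_scaleDl v : {morph imod_scale^~ v : x y / x + y}.
Proof.
move=> x y; apply: iat_ext => w wab; rewrite iatD !iat_of wab -big_split /=.
by apply: eq_bigr => j _; rewrite linearD mulrDr.
Qed.

HB.instance Definition _ := GRing.Zmodule_isLmodule.Build L^c (imod bp)
  imod_scaleA imod_scale1 imod_scaleDr imod_scaleDl.

Lemma iatZ (y : L^c) (v : imod bp) w : (a <= w < b)%N ->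
  iat (y *: v) w = \sum_(a <= j < b) iat v j * coef j w y.
Proof. by move=> wab; rewrite [LHS]iat_of wab. Qed.
End Structure.

Section Truncation.
Variables (a b c e : nat) (bp : (b <= p a)%N) (ep : (e <= p c)%N).
Hypotheses (ca : (c <= a)%N) (eb : (e <= b)%N).
(** Final segments of an interval are submodules and initial segments are quotients: this is the
    quotient map from [[a, b)] to [[a, e)] followed by the inclusion into [[c, e)]. *)
Definition trunc_fun (v : imod bp) : imod ep := ivec_of c e (iat v).

Lemma trunc_linear : linear trunc_fun.
Proof.
move=> y u v; apply: iat_ext => w /[dup] wce /andP[cw we].
rewrite iatD iatZ // !iat_of wce iatD; congr (_ + _).
have [aw|wa] := leqP a w; last first.
  have -> : iat (y *: u) w = 0 by apply: iat_out; rewrite negb_and -ltnNge wa.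
  apply/esym; rewrite big_nat_cond big1 // => j /andP[/andP[cj je] _].
  rewrite iat_of cj je /=; have [aj|ja] := leqP a j.
    by rewrite nd_coef_low ?mulr0 // (leq_trans wa).
  by rewrite iat_out ?mul0r // negb_and -ltnNge ja.
rewrite iatZ ?aw ?(leq_trans we) //.
transitivity (\sum_(a <= j < e) iat u j * coef j w y).
  apply: big_nat_restrict => // j /andP[aj jb]; rewrite aj /= -leqNgt => ej.
  by rewrite nd_coef_low ?mulr0 // (leq_trans we).
apply/esym; transitivity (\sum_(a <= j < e) iat (trunc_fun u) j * coef j w y).
  apply: big_nat_restrict => // j /[dup] jce /andP[cj je]; rewrite je andbT.
  by move=> aj; rewrite iat_of jce iat_out ?mul0r // negb_and aj.
by apply: eq_big_nat => j /andP[aj je]; rewrite iat_of je (leq_trans ca).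
Qed.
Definition trunc : {linear imod bp -> imod ep} := linear_of trunc_linear.

Lemma iat_trunc v j : iat (trunc v) j = if (c <= j < e)%N then iat v j else 0.
Proof. exact: iat_of. Qed.
End Truncation.

Section Generator.
Variables (a b : nat) (bp : (b <= p a)%N).

Definition igen : imod bp := ivec_of a b (fun j => (j == a)%:R).
Definition ilift (v : imod bp) : L := \sum_(a <= w < b) iat v w *: path a w.

Lemma iat_igenZ (y : L^c) w : (a <= w < b)%N -> iat (y *: igen) w = coef a w y.
Proof.
move=> /[dup] wab /andP[aw wb]; rewrite iatZ // big_ltn ?(leq_ltn_trans aw) //.
rewrite iat_of leqnn (leq_ltn_trans aw) //= eqxx mul1r.
rewrite big_nat_cond big1 ?addr0 // => j /andP[/andP[aj jb] _].
by rewrite iat_of (ltnW aj) jb /= gtn_eqF // mul0r.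
Qed.

Lemma igen_lift (v : imod bp) : (ilift v : L^c) *: igen = v.
Proof.
apply: iat_ext => w /[dup] wab /andP[aw wb]; rewrite iat_igenZ // linear_sum /=.
under eq_big_nat => i /andP[ai ib].
  rewrite linearZ /= nd_coef_row ?aw ?ai ?(imod_p bp) //.
  over.
rewrite (@big_nat_restrict _ _ a b w w.+1) // ?big_nat1 ?eqxx ?mulr1 //.
by move=> i _; rewrite ltnS -eqn_leq => /negPf->; rewrite mulr0.
Qed.

Lemma imod_fg : finitely_generated (imod bp).
Proof.
exists 1%N, (fun=> igen) => v; exists (fun=> ilift v : L^c).
by rewrite big_ord1 igen_lift.
Qed.
End Generator.

Definition pmod u : rmodType L := imod (leqnn (p u)).

Lemma ilift_idem u (v : pmod u) : path u u * ilift v = ilift v.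
Proof.
rewrite nd_row; apply: eq_big_nat => w wu.
by rewrite -(iat_igenZ (leqnn (p u))) // igen_lift.
Qed.

(** Thus [ilift] identifies [pmod u] with the right ideal generated by the idempotent [path u u]. *)
Lemma ilift_linear u (y : L) (v v' : pmod u) :
  ilift ((y : L^c) *: v + v') = ilift v * y + ilift v'.
Proof.
have -> : ilift v * y = ilift ((y : L^c) *: v).
  rewrite -ilift_idem -mulrA nd_row; apply: eq_big_nat => w wu.
  by rewrite -{2}(igen_lift v) scalerA iat_igenZ.
by rewrite -big_split /=; apply: eq_bigr => w _; rewrite iatD scalerDl.
Qed.

Lemma pmod_projective u : projective (pmod u).
Proof.
move=> M N g f gs; have [x xP] := gs (f (igen _)).
have hl : linear (fun v : pmod u => (ilift v : L^c) *: x).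
  by move=> y v v'; rewrite ilift_linear scalerDl scalerA.
by exists (linear_of hl) => v /=; rewrite linearZ xP -linearZ igen_lift.
Qed.
End IntervalModule.

(** * Syzygies and extensions of interval modules *)

(* [syz p a b i] is the left end of the i-th syzygy of [[a, b)].              *)
Fixpoint syz (p : nat -> nat) (a b i : nat) : nat :=
  if i is i'.+1 then syz p b (p a) i' else a.

Lemma syzSS p a b i : syz p a b i.+2 = p (syz p a b i).
Proof. by elim: i a b => //= i IH a b; rewrite -IH. Qed.

Section IntervalResolution.
Variables (K : fieldType) (L : algType K) (D : nakayama_data L).
Local Notation p := (nd_p D).
Local Notation coef := (nd_coef D).
Local Notation path := (nd_path D).
Local Notation pmod := (pmod D).

(** The kernel of the second map consists of the vectors supported at positions from [b3] on, the
    image of the first of those supported from [a1] on. *)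
Lemma trunc_exact a1 b1 a2 b2 a3 b3 (b1p : (b1 <= p a1)%N) (b2p : (b2 <= p a2)%N)
    (b3p : (b3 <= p a3)%N) (a21 : (a2 <= a1)%N) (b21 : (b2 <= b1)%N)
    (a32 : (a3 <= a2)%N) (b32 : (b3 <= b2)%N) (v : imod b2p) :
  a1 = b3 -> trunc b2p b3p a32 b32 v = 0 <-> exists y, trunc b1p b2p a21 b21 y = v.
Proof.
move=> a1b3; split=> [v0|[y <-]]; last first.
  apply: iat_ext => j /andP[aj jb]; rewrite iat0 !iat_trunc aj jb.
  by rewrite iat_out ?if_same // a1b3 leqNgt jb.
exists (ivec_of a1 b1 (iat v)); apply: iat_ext => j /[dup] j2 /andP[aj jb].
rewrite iat_trunc j2 iat_of (leq_trans jb) // andbT a1b3.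
case: leqP => // jb3; have := iat_trunc b3p a32 b32 v j.
by rewrite v0 iat0 (leq_trans a32) // jb3 /= => <-.
Qed.

Section Resolution.
Variables (a b : nat) (ab : (a <= b)%N) (bp : (b <= p a)%N).
Local Notation x := (syz p a b).

Lemma syz_le i : (x i <= x i.+1)%N.
Proof.
elim: i a b ab bp => //= i IH a' b' a'b' b'p; apply: IH => //.
exact: nd_p_mono.
Qed.

Lemma syz_p_le i : (x i.+2 <= p (x i.+1))%N.
Proof. by rewrite syzSS nd_p_mono // syz_le. Qed.

Lemma syz_ple i : (p (x i) <= p (x i.+1))%N.
Proof. by rewrite nd_p_mono // syz_le. Qed.

Definition ires_diff i : {linear pmod (x i.+1) -> pmod (x i)} :=
  trunc _ _ (syz_le i) (syz_ple i).

Definition ires_aug : {linear pmod (x 0) -> imod bp} :=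
  trunc (leqnn (p (x 0))) bp (leqnn _) bp.

Lemma ires_exact0 v : ires_aug v = 0 <-> exists y, ires_diff 0 y = v.
Proof. exact: trunc_exact. Qed.

Lemma ires_exact i v : ires_diff i v = 0 <-> exists y, ires_diff i.+1 y = v.
Proof. by apply: trunc_exact; rewrite syzSS. Qed.

Lemma ires_surj v : exists y, ires_aug y = v.
Proof.
exists (ivec_of (x 0) (p (x 0)) (iat v)); apply: iat_ext => j /[dup] jab /andP[aj jb].
by rewrite iat_trunc jab iat_of /= aj (leq_trans jb).
Qed.

Definition ires : projective_resolution (imod bp) :=
  @ProjectiveResolution _ _ (fun i => pmod (x i)) ires_diff ires_aug
    (fun i => @pmod_projective _ _ _ (x i)) ires_surj ires_exact0 ires_exact.

Lemma ires_diff_igen i : (x i.+1 < x i.+2)%N ->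
  ires_diff i (igen _) = (path (x i) (x i.+1) : L^c) *: igen (leqnn (p (x i))).
Proof.
rewrite syzSS => ltx; apply: iat_ext => j /[dup] jx /andP[xj jp].
rewrite iat_igenZ // nd_coef_row ?syz_le // iat_trunc jx iat_of.
have [->|jN] := eqVneq j (x i.+1); first by rewrite leqnn (leq_trans ltx) // -syzSS syz_p_le.
by case: ifP.
Qed.

(** The truncation from [pmod (x i.+1)] to [[c, e)] is a cocycle since [e <= x i.+2]. If it factored
    through [pmod (x i)], its value at the generator would have at [x i.+1] the coordinate that some
    vector of [[c, e)] has at [x i]. This is 0 as [x i < c], while the truncation gives 1. *)
Lemma Ext_imod_neq0 c e (ep : (e <= p c)%N) i :
  (x i < c)%N -> (c <= x i.+1)%N -> (x i.+1 < e)%N -> (e <= x i.+2)%N ->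
  ~ Ext_eq0 i.+1 (imod bp) (imod ep).
Proof.
move=> xc cx xe ex [R /(@Hom_acyclic_indep _ _ R ires)] acR.
have ex' : (e <= p (x i.+1))%N by apply: leq_trans ex (syz_p_le i).
pose f := trunc (leqnn (p (x i.+1))) ep cx ex'.
have [v|g gP] := acR f.
  apply: iat_ext => j /[dup] jce /andP[cj je]; rewrite iat0 /f iat_trunc jce iat_trunc.
  by rewrite [iat v j]iat_out ?if_same // negb_and -ltnNge (leq_trans je).
have xx : (x i.+1 < x i.+2)%N by apply: leq_trans xe ex.
have := congr1 (fun v : imod ep => iat v (x i.+1)) (gP (igen _)); rewrite ires_diff_igen // linearZ.
rewrite iat_trunc iat_of cx xe leqnn (leq_trans xx (syz_p_le i)) eqxx /=.
rewrite iatZ ?cx // big_nat_cond big1 => [/eqP|j /andP[/andP[cj je] _]].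
  by rewrite oner_eq0.
have [jx|xj] := leqP j (x i.+1); last by rewrite nd_coef_low ?mulr0.
rewrite nd_coef_col ?syz_le ?jx ?(imod_p ep cj) //.
by rewrite gtn_eqF ?mulr0 // (leq_trans xc).
Qed.
End Resolution.

(** Otherwise [[a, b)] would have a nonzero extension of degree [d.+1] with the simple module at
    [syz p a b d.+1]. *)
Lemma gldim_syz d a b : gldim_le L d -> (a <= b <= p a)%N ->
  (syz p a b d < syz p a b d.+1)%N -> ~~ (syz p a b d.+1 < syz p a b d.+2)%N.
Proof.
move=> gd /andP[ab bp] lt1; apply/negP => lt2.
have [R R0] := gd _ (imod_fg bp).
have ep : ((syz p a b d.+1).+1 <= p (syz p a b d.+1))%N.
  exact: leq_trans lt2 (syz_p_le ab bp d).
apply: (@Ext_imod_neq0 a b ab bp _ _ ep d) => //.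
by exists R => f _; exists \0 => y; rewrite (R0 d.+1 _ y) // !linear0.
Qed.
End IntervalResolution.

(** * Projectives and injectives in the cluster tilting subcategory *)

Lemma projective_pd0 (A : nzRingType) (P : rmodType A) :
  projective P -> projdim_le P 0.
Proof.
move=> projP; pose Z : rmodType A := 'rV[A^c]_0.
have Z0 (z : Z) : z = 0 by apply/matrixP => ? [].
pose T i : rmodType A := if i is 0 then P else Z.
have TP i : projective (T i).
  case: i => [//|i] M N g f gs; exists \0 => z.
  by rewrite [z]Z0 !linear0.
pose d i : {linear T i.+1 -> T i} := \0.
have e0 (x : T 0) : idfun x = 0 <-> exists y, d 0%N y = x.
  by split=> [/= ->|[y <-]] //; exists 0.
have ex i (x : T i.+1) : d i x = 0 <-> exists y, d i.+1 y = x.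
  by split=> // _; exists 0; rewrite [x]Z0.
exists (@ProjectiveResolution _ _ T d (idfun : {linear T 0 -> P}) TP
  (fun y => ex_intro _ y erefl) e0 ex).
by case=> // i _ x; exact: Z0.
Qed.

Lemma projdim_le_Ext (A : nzRingType) (M N : rmodType A) n i :
  projdim_le M n -> (n < i)%N -> Ext_eq0 i M N.
Proof.
move=> [R R0]; case: i => // i ni; exists R => f _.
by exists \0 => x; rewrite [x]R0 // !linear0.
Qed.

Section InjectiveIntervals.
Variables (K : fieldType) (L : algType K) (D : nakayama_data L).
Local Notation p := (nd_p D).
Local Notation coef := (nd_coef D).
Local Notation path := (nd_path D).

Lemma iat_alg a b (bp : (b <= p a)%N) (c : K) (v : imod bp) w :
  iat ((c%:A : L^c) *: v) w = c * iat v w.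
Proof.
have [wab|wN] := boolP (a <= w < b)%N; last by rewrite !iat_out ?mulr0.
rewrite -{2}[v]scale1r !iatZ // mulr_sumr; apply: eq_bigr => j _.
by rewrite linearZ /= mulrCA.
Qed.

(* [[a, b)] is the dual of a projective left module: a homomorphism to it is  *)
(* determined by its last coordinate, which may be any linear functional.     *)
Lemma imod_injective a b (bp : (b <= p a)%N) (X Y : rmodType L)
    (h : {linear X -> Y}) (f : {linear X -> imod bp}) :
  nd_inj D a b -> (forall x, h x = 0 -> f x = 0) ->
  exists g : {linear Y -> imod bp}, forall x, f x = g (h x).
Proof.
move=> injab hf; have /and3P[ab _ _] := injab.
have b1 : (a <= b.-1 < b)%N by case: b ab {bp f injab hf} => //= b; rewrite ltnS leqnn andbT.
(* Since [f] kills the kernel of [h], the last coordinate of [f] extends along [h] to a functional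
   [mu] on [Y]. *)
have [s sP] := linear_ginv (linear_of (linear_restr h)).
pose mu (y : Y) := iat (f (s y)) b.-1.
have muP c y y' : mu ((c%:A : L^c) *: y + y') = c * mu y + mu y'.
  by rewrite /mu [s _](linearP s c y y') [f _]linearP iatD iat_alg.
have muD y y' : mu (y + y') = mu y + mu y'.
  by have := muP 1 y y'; rewrite !scale1r mul1r.
have mu0 : mu 0 = 0 by rewrite /mu [s 0](linear0 s) linear0 iat0.
have muh x : mu (h x) = iat (f x) b.-1.
  rewrite /mu; congr iat; apply/subr0_eq; rewrite -linearB hf //.
  by rewrite linearB; apply/eqP; rewrite subr_eq0; apply/eqP/sP.
have mu_sum (z : nat -> K) (q : nat -> L) y :
    mu (((\sum_(a <= j < b) z j *: q j : L) : L^c) *: y) =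
    \sum_(a <= j < b) z j * mu ((q j : L^c) *: y).
  elim: (index_iota a b) => [|j r IH].
    by rewrite !big_nil scale0r.
  rewrite !big_cons -IH scalerDl -muP; congr mu; congr (_ + _).
  by rewrite scalerA; congr (_ *: _); rewrite -[RHS]/(q j * (z j)%:A) mulr_algr.
have gl : linear (fun y => ivec_of a b (fun j => mu ((path j b.-1 : L^c) *: y)) : imod bp).
  move=> z y y'; apply: iat_ext => w wab; rewrite iatD iatZ // !iat_of wab.
  rewrite scalerDr muD scalerA; congr (_ + _).
  (* This uses [nd_inj]: no nonzero path ending at [b.-1] starts before [a], so the paths from
     [[a, b)] to [b.-1] span a left ideal. *)
  have zE : (path w b.-1 : L^c) * z = \sum_(a <= j < b) coef j w z *: path j b.-1.
    exact: (nd_col (z : L) injab wab).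
  rewrite zE mu_sum; apply: eq_big_nat => j jab.
  by rewrite iat_of jab mulrC.
exists (linear_of gl) => x; apply: iat_ext => w /[dup] wab /andP[aw wb].
rewrite iat_of wab -linearZ muh linearZ iatZ //.
have wb1 : (w <= b.-1)%N by rewrite -ltnS (ltn_predK wb).
rewrite (@big_nat_restrict _ _ a b w w.+1) // ?big_nat1.
  by rewrite nd_coef_col ?eqxx ?mulr1 ?wb1 ?(imod_p bp aw) // (andP b1).2.
move=> j /andP[aj jb]; rewrite ltnS -eqn_leq => wj.
have jb1 : (j <= b.-1)%N by rewrite -ltnS (ltn_predK jb).
rewrite nd_coef_col ?jb1 ?(imod_p bp aj (andP b1).2) //.
by rewrite eq_sym (negPf wj) mulr0.
Qed.

Variables (d : nat) (C : rmodType L -> Prop).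
Hypotheses (gd : gldim_le L d) (ctC : cluster_tilting d C).

(** [nd_inj] says that [[a, b)] cannot be extended to the left. A cocycle with values in it kills
    the kernel of the differential, hence extends along the differential. *)
Lemma injective_interval_in_ct a b (bp : (b <= p a)%N) : nd_inj D a b -> C (imod bp).
Proof.
move=> injab; apply/(ct_right ctC); split; first exact: imod_fg.
move=> Y CY [//|i] _; have [R _] := gd (ct_fg ctC CY).
exists R => f fd; apply: (imod_injective injab) => x.
by move/res_exact => [y <-].
Qed.

Lemma projective_interval_in_ct u : C (pmod D u).
Proof.
apply/(ct_left ctC); split=> [|Y CY i /andP[i0 _]]; first exact: imod_fg.
apply: projdim_le_Ext i0; apply: projective_pd0; exact: pmod_projective.
Qed.

(** With [x] the left ends of the syzygies, [p (x i).+1 <= p (x i)] would make the extension group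
    of degree [i.+1] from [[a, b)] to the projective at [(x i).+1] nonzero, though both modules lie
    in [C]. *)
Lemma ct_syz a b i : nd_inj D a b -> (i.+1 < d)%N ->
  (syz p a b i < syz p a b i.+1 < syz p a b i.+2)%N ->
  (p (syz p a b i) < p (syz p a b i).+1)%N.
Proof.
move=> injab id /andP[lt1 lt2]; have /and3P[ab bp _] := injab.
rewrite ltnNge; apply/negP => le_p.
apply: (@Ext_imod_neq0 _ _ _ a b (ltnW ab) bp _ _ (leqnn _) i (ltnSn _)) => //.
- by apply: leq_trans lt2 _; rewrite syzSS nd_p_mono.
- by rewrite syzSS.
apply: ((ct_right ctC _).1 (projective_interval_in_ct _)).2 => //.
exact: injective_interval_in_ct.
Qed.
End InjectiveIntervals.

(** * Combinatorics of Kupisch functions *)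

Section Combinatorics.
Variables (p : nat -> nat) (d : nat) (start : bool).
Local Notation syz := (syz p).
Local Notation inj a b :=
  [&& (a < b)%N, (b <= p a)%N & if a is a'.+1 then (p a' < b)%N else start].
Hypotheses (p_ge : forall u, (u <= p u)%N)
  (p_mono : forall u v, (u <= v)%N -> (p u <= p v)%N) (d_ge2 : (2 <= d)%N)
  (pdA : forall a b, (a <= b <= p a)%N ->
     (syz a b d < syz a b d.+1)%N -> ~~ (syz a b d.+1 < syz a b d.+2)%N)
  (extB : forall a b i, inj a b -> (i.+1 < d)%N ->
     (syz a b i < syz a b i.+1 < syz a b i.+2)%N ->
     (p (syz a b i) < p (syz a b i).+1)%N).

(** Induction: if [x_j < x_(j+1) < x_(j+2)], then [extB] gives [x_(j+2) = p x_j < p (x_j).+1 <= p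
    x_(j+1) = x_(j+3)]. *)
Lemma inj_strict a b i : inj a b -> (b < p a)%N -> (i <= d)%N ->
  (syz a b i < syz a b i.+1)%N.
Proof.
move=> injab bp; have /and3P[ab _ _] := injab.
suff H j : (j < d)%N -> (syz a b j < syz a b j.+1 < syz a b j.+2)%N.
  case: i => // i /H /andP[] //.
elim: j => [|j IH] jd; first by rewrite /= ab.
have lt2 := IH (ltnW jd); have /andP[lt _] := lt2.
rewrite (andP lt2).2 andTb (syzSS _ _ _ j.+1) (syzSS _ _ _ j).
exact: leq_trans (extB injab jd lt2) (p_mono lt).
Qed.

Lemma inj_nonflat a b i : inj a b -> (b < p a)%N -> (i.+1 < d)%N ->
  (p (syz a b i) < p (syz a b i).+1)%N.
Proof.
move=> injab bp id; apply: extB => //; apply/andP; split.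
  exact: inj_strict injab bp (ltnW (ltnW id)).
exact: inj_strict injab bp (ltnW id).
Qed.

(* If [p] jumped at [a.+1], the simple module at [a] would have projective    *)
(* dimension larger than [d]: compare its syzygies with those of the          *)
(* injective [[a.+1, (p a).+1)].                                              *)
Lemma no_jump a : (a.+2 <= p a)%N -> (p a.+1 <= (p a).+1)%N.
Proof.
move=> ap; rewrite leqNgt; apply/negP => jump.
have injab : inj a.+1 (p a).+1 by apply/and3P; split; rewrite ?ltnS // ltnW.
pose x := syz a.+1 (p a).+1; pose w := syz a.+1 (p a).
(* The sequences start at the same position and [w 1] is one less than [x 1]; applying [p] keeps
   equality at even indices and the inequality at odd ones. *)
have wx i : (w i <= x i)%N /\ (~~ odd i -> w i = x i).
  suff: ((w i <= x i)%N /\ (~~ odd i -> w i = x i)) /\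
        ((w i.+1 <= x i.+1)%N /\ (~~ odd i.+1 -> w i.+1 = x i.+1)) by case.
  elim: i => [|i [[IH1 IH2] IH]]; first by split; split=> //=.
  split=> //; rewrite /w /x !syzSS negbK; split; first exact: p_mono.
  by move=> /= oi; congr p; apply: IH2; rewrite oi.
(* From an odd index, pass through [x] and return to [w] at the next, even index. From an even index
   [i.+2], use that [p] is not flat at [x i = w i]. *)
have lt i : (i <= d)%N -> (w i < w i.+1)%N.
  have [n] := ubnP i; elim: n i => // n IH [|[|i]] /ltnSE iN id.
  - exact: ap.
  - have := inj_strict injab jump id; rewrite -/x.
    by rewrite -(wx 2%N).2 //; apply: leq_ltn_trans; apply: (wx 1%N).1.
  have [oi|ei] := boolP (odd i).
    apply: leq_ltn_trans (wx _).1 _; rewrite (wx i.+3).2 /= ?oi //.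
    exact: inj_strict.
  rewrite [w i.+2]syzSS [w i.+3]syzSS -/w (wx i).2 //.
  apply: leq_trans (inj_nonflat injab jump (i := i) id) _; apply: p_mono.
  by rewrite -/x -(wx i).2 // IH // ltnW // ltnW.
have aw i : syz a a.+1 i.+1 = w i by [].
have := pdA (a := a) (b := a.+1); rewrite leqnSn (ltnW ap) /= => /(_ isT).
case: d d_ge2 lt => // d' _ lt; rewrite !aw lt // => /(_ isT).
by rewrite lt.
Qed.

(** Each step raises [p] by at most 1 and a period of [n] steps raises it by [n], so [p] is strictly
    increasing. Then no syzygy of the simple module at 0 vanishes. *)
Lemma periodic_absurd n : (0 < n)%N -> (forall u, p (u + n) = p u + n)%N ->
  (forall u, u.+2 <= p u)%N -> False.
Proof.
move=> n0 per p2.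
have lek u k : (p (u + k) <= p u + k)%N.
  elim: k => [|k IH]; first by rewrite !addn0.
  by rewrite !addnS; apply: leq_trans (no_jump (p2 _)) _; rewrite ltnS.
have pS u : (p u < p u.+1)%N.
  by have := lek u.+1 n.-1; rewrite addSnnS prednK // per; lia.
have lt i a b : (a < b)%N -> (b < p a)%N -> (syz a b i < syz a b i.+1)%N.
  elim: i a b => //= i IH a b ab bp; apply: IH => //.
  by apply: leq_trans (pS a) (p_mono ab).
have := pdA (a := 0) (b := 1); rewrite leq0n (ltnW (p2 0%N)).
have l01 i := lt i 0%N 1%N (ltnSn 0) (p2 0%N).
by move=> /(_ isT (l01 d)); rewrite l01.
Qed.

Section Linear.
Variable m : nat.
Hypotheses (m_ge2 : (2 <= m)%N) (start1 : start)
  (p_le : forall u, (u <= m)%N -> (p u <= m)%N)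
  (p_out : forall u, (m <= u)%N -> p u = u)
  (p_ge2 : forall u, (u.+1 < m)%N -> (u.+2 <= p u)%N).
Local Notation l := (p 0).

Lemma l_ge2 : (2 <= l)%N. Proof. exact: p_ge2. Qed.

(** As [2 <= d], the syzygies of the injective [[0, 1)] give [2 <= p 0 < p 1 <= m]. *)
Lemma m_ge3 : (3 <= m)%N.
Proof.
have := @inj_strict 0 1 2; rewrite start1 l_ge2 (ltnW l_ge2) /=.
move=> /(_ isT isT d_ge2) lt; apply: leq_trans (p_le (ltnW m_ge2)).
by apply: leq_trans lt; rewrite ltnS l_ge2.
Qed.

Lemma p_step u : (p u.+1 <= (p u).+1)%N.
Proof.
have [um|mu] := ltnP u.+1 m; first exact/no_jump/p_ge2.
by rewrite p_out // ltnS.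
Qed.

Lemma syz_even a b s j : (forall k, (k <= s)%N -> p k = k + l)%N ->
  (a + j * l <= s + l)%N -> syz a b j.*2 = (a + j * l)%N.
Proof.
move=> ps; elim: j => [|j IH] ajs; first by rewrite addn0.
rewrite mulSn in ajs; have le : (a + j * l <= s)%N by lia.
by rewrite doubleS syzSS (IH (leq_trans le (leq_addr _ _))) (ps _ le) mulSn; lia.
Qed.

Lemma syz_odd a b s j : (forall k, (k <= s)%N -> p k = k + l)%N ->
  (b + j * l <= s + l)%N -> syz a b j.*2.+1 = (b + j * l)%N.
Proof. by move=> ps bjs; apply: (@syz_even b (p a) s). Qed.

(* With [s = r * l + b], compare the syzygies of the injective [[0, b)] and of *)
(* the simple module [[b.-1, b)], or only those of [[0, l.-1)] if [b = 0].    *)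
Lemma flat_end s : (s.+1 < m)%N -> (forall k, (k <= s)%N -> p k = k + l)%N ->
  p s.+1 = p s -> p s = m.
Proof.
move=> sm ps flat; apply/eqP; rewrite eqn_leq p_le ?(ltnW (ltnW sm)) //= leqNgt.
apply/negP => lt_m; have l2 := l_ge2.
have eE : p s = (s + l)%N by rewrite ps.
(* The assumption [s + l < m] is used here; it makes one more syzygy nonzero beyond those computed
   by [syz_even] and [syz_odd]. *)
have pe : (s + l < p (s + l).-1)%N.
  have := @p_ge2 (s + l).-1; rewrite prednK; last by lia.
  by rewrite -eE; apply.
have sE := divn_eq s l; set r := (s %/ l)%N in sE; set b := (s %% l)%N in sE.
have bl : (b < l)%N by rewrite ltn_mod ltnW.
have rl j : (j <= r)%N -> (j * l <= r * l)%N by move=> jr; rewrite leq_mul2r jr orbT.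
have [b0|b0] := posnP b.
  have s0 : s = (r * l)%N by rewrite sE b0 addn0.
  have il : inj 0 l.-1 by apply/and3P; split; lia.
  have ll : (l.-1 < l)%N by lia.
  (* Syzygy [r.*2] of the injective [[0, l.-1)] starts at [s], where [p] is flat. *)
  have dr : (d <= r.*2.+1)%N.
    rewrite leqNgt; apply/negP => dr.
    have := inj_nonflat il ll dr; rewrite (syz_even _ ps); last by lia.
    by rewrite -s0 flat ltnn.
  have ev j : (j <= r.+1)%N -> syz 0 l.-1 j.*2 = (j * l)%N.
    by move=> jr; rewrite (syz_even _ ps) //; case: j jr => // j /rl; rewrite mulSn; lia.
  have od j : (j <= r)%N -> syz 0 l.-1 j.*2.+1 = (l.-1 + j * l)%N.
    by move=> /rl jr; rewrite (syz_odd _ ps) //; lia.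
  (* The left ends are [0, l.-1, l, ...] up to [r.+1 * l = s + l]; the last inequality, at
     [i = r.+1.*2], is [pe]. Its length contradicts [pdA] because of [dr]. *)
  have lt i : (i <= r.+1.*2)%N -> (syz 0 l.-1 i < syz 0 l.-1 i.+1)%N.
    rewrite -[i]odd_double_half; case: (odd i) => ir.
      have jr : (i./2 <= r)%N by move: ir; rewrite doubleS; lia.
      by rewrite od // -doubleS ev // mulSn; lia.
    have jr : (i./2 <= r.+1)%N by move: ir; rewrite doubleS; lia.
    rewrite add0n ev //; have [jr'|rj] := leqP i./2 r; first by rewrite od //; lia.
    have -> : (i./2 = r.+1)%N by lia.
    rewrite doubleS syzSS od // mulSn -s0 addnC.
    by have -> : (l.-1 + s = (s + l).-1)%N by lia.
  have := pdA (a := 0) (b := l.-1); rewrite leq0n (ltnW ll) => /(_ isT (lt d _)).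
  by rewrite lt; [move=> /(_ _)| ]; rewrite doubleS; lia.
have ibl : (b.-1 <= b <= p b.-1)%N by rewrite leq_pred ps; lia.
(* The simple [[b.-1, b)] has syzygies [r.*2.+2] and [r.*2.+3] starting at [(s + l).-1] and [s + l],
   both nonzero, the latter by [pe]; [pdA] then excludes a smaller [d]. *)
have dr : (r.*2.+2 < d)%N.
  have ev j : (j <= r.+1)%N -> syz b.-1 b j.*2 = (b.-1 + j * l)%N.
    move=> jr; rewrite (syz_even _ ps) //.
    by case: j jr => [|j /rl]; rewrite ?mulSn; lia.
  have od j : (j <= r.+1)%N -> syz b.-1 b j.*2.+1 = (b + j * l)%N.
    move=> jr; rewrite (syz_odd _ ps) //.
    by case: j jr => [|j /rl]; rewrite ?mulSn; lia.
  have lt i : (i <= r.*2.+3)%N -> (syz b.-1 b i < syz b.-1 b i.+1)%N.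
    rewrite -[i]odd_double_half; case: (odd i) => ir; last first.
      by rewrite add0n ev ?od; lia.
    rewrite add1n od -?doubleS; last by lia.
    have [jr|rj] := leqP i./2 r; first by rewrite ev // mulSn; lia.
    have -> : (i./2 = r.+1)%N by lia.
    rewrite doubleS syzSS ev //.
    have -> : (b.-1 + r.+1 * l = (s + l).-1)%N by rewrite mulSn; lia.
    by apply: leq_trans pe; rewrite mulSn; lia.
  rewrite ltnNge; apply/negP => dr.
  by have := pdA ibl (lt d _); rewrite lt; lia.
(* Syzygy [r.*2.+1] of the injective [[0, b)] starts at [s], within the range where flatness is
   excluded. *)
have ib : inj 0 b by apply/and3P; split; lia.
have := inj_nonflat ib bl (i := r.*2.+1) dr; rewrite (syz_odd _ ps); last by lia.
have -> : (b + r * l = s)%N by lia.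
by rewrite flat ltnn.
Qed.

Lemma p_homogeneous u : (u < m)%N -> p u = minn (u + l) m.
Proof.
(* Strong induction makes [p k = k + l] up to [s], so that [flat_end] applies at the first flat
   position. *)
have flatN s : (s.+1 < m)%N -> (p s < m)%N -> p s.+1 = (p s).+1.
  elim/ltn_ind: s => s IH sm pm; apply/eqP; rewrite eqn_leq p_step ltn_neqAle p_mono //.
  rewrite andbT; apply/eqP => flat; move: (pm); rewrite (@flat_end s) ?ltnn //.
  elim=> // k IHk ks; have km : (p k < m)%N := leq_ltn_trans (p_mono (ltnW ks)) pm.
  by rewrite IH // ?(IHk (ltnW ks)) // (leq_ltn_trans _ sm) // ltnW.
elim: u => [|u IH] um; first by rewrite add0n; apply/esym/minn_idPl/p_le.
have um' := ltnW um; have [pm|mp] := ltnP (p u) m.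
  by rewrite flatN //; have := IH um'; lia.
have := IH um'; have := p_le (ltnW um); have := p_mono (leqnSn u); lia.
Qed.
End Linear.
End Combinatorics.

(** * Powers of the arrow ideal of a path algebra *)

Section PathAlgebraGeneral.
Variables (K : fieldType) (Q : quiver).
Local Notation KQ := (path_algebra K Q).
Implicit Types (x y z : KQ) (p q r : qpath Q) (c : K).

Definition pbasis q : KQ := path_elt 1 q.

Lemma pbasisE q r : (pbasis q)@_r = (q == r)%:R.
Proof. by rewrite mcoeffU. Qed.

Lemma pbasis_inj : injective pbasis.
Proof.
move=> q r qr; apply/eqP; have := pbasisE q r.
rewrite qr pbasisE eqxx.
by case: (q == r); [|move/eqP; rewrite oner_eq0].
Qed.

Lemma pexpand x : x = \sum_(q <- msupp x) x@_q *: pbasis q.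
Proof.
rewrite [LHS](pa_expand x); apply: eq_bigr => q _; apply/malgP => r.
have cE c : (path_elt c q)@_r = c *+ (q == r) by exact: mcoeffU.
by rewrite (cE x@_q) mcoeffZ (pbasisE q r) mulr_natr.
Qed.

Lemma pbasisM q r : pbasis q * pbasis r =
  if qpath_cat q r is Some s then pbasis s else 0.
Proof. by rewrite [LHS]pa_mulUU mulr1. Qed.

Lemma pbasis_cat q r s : qpath_tgt q = qpath_src r ->
  val s = (qpath_src q, (val q).2 ++ (val r).2) -> pbasis q * pbasis r = pbasis s.
Proof.
move=> qr sE; rewrite pbasisM; have [s' -> s'E] := qpath_catP qr.
by congr pbasis; apply: val_inj; rewrite s'E.
Qed.

Lemma pbasisM0 q r : qpath_tgt q != qpath_src r -> pbasis q * pbasis r = 0.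
Proof. by move=> qr; rewrite pbasisM qpath_catN. Qed.

Lemma plinear_ext (V : lmodType K) (f g : KQ -> V) : linear f -> linear g ->
  (forall q, f (pbasis q) = g (pbasis q)) -> forall x, f x = g x.
Proof.
move=> lf lg fg x; rewrite -[f]/(linear_of lf : _ -> _) -[g]/(linear_of lg : _ -> _).
rewrite (pexpand x) !linear_sum; apply: eq_bigr => q _.
by rewrite !linearZ; congr (_ *: _); apply: fg.
Qed.

Section IdealClosure.
Variables (J : KQ -> Prop) (idJ : ideal J).
Lemma ideal0 : J 0. Proof. by case: idJ => -[]. Qed.
Lemma idealD x y : J x -> J y -> J (x + y). Proof. by case: idJ => -[_ + _] _; apply. Qed.
Lemma idealMr x y : J x -> J (x * y). Proof. by case: idJ => -[_ _ +] _; apply. Qed.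
Lemma idealMl x y : J y -> J (x * y). Proof. by case: idJ => _; apply. Qed.
Lemma idealZ c x : J x -> J (c *: x).
Proof. by move=> Jx; rewrite -[x]mulr1 scalerAr; apply: idealMr. Qed.
Lemma ideal_sum (I : eqType) (s : seq I) (P : pred I) (G : I -> KQ) :
  (forall i, i \in s -> P i -> J (G i)) -> J (\sum_(i <- s | P i) G i).
Proof.
by move=> JG; rewrite big_seq_cond; apply: big_rec => [|i x /andP[? ?]];
  [exact: ideal0 | apply: idealD; apply: JG].
Qed.
End IdealClosure.

(** A description by coefficients of the [n]-th power of the arrow ideal, see [ideal_exp_long]. *)
Definition long_paths n x := forall q, x@_q != 0 -> (n <= size (val q).2)%N.

Lemma qpath_cat_size q r s : qpath_cat q r = Some s ->
  size (val s).2 = (size (val q).2 + size (val r).2)%N.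
Proof.
case: (eqVneq (qpath_tgt q) (qpath_src r)) => qr; last by rewrite qpath_catN.
by have [s' -> s'E] := qpath_catP qr; case=> <-; rewrite s'E size_cat.
Qed.

Lemma long_paths0 n : long_paths n 0.
Proof. by move=> q; rewrite mcoeff0 eqxx. Qed.

Lemma long_pathsD n x y : long_paths n x -> long_paths n y -> long_paths n (x + y).
Proof.
move=> xn yn q; rewrite mcoeffD => xy; have [x0|] := eqVneq x@_q 0; last exact: xn.
by apply: yn; rewrite x0 add0r in xy.
Qed.

Lemma long_pathsZ n c x : long_paths n x -> long_paths n (c *: x).
Proof. by move=> xn q; rewrite mcoeffZ mulf_eq0 negb_or => /andP[_]; apply: xn. Qed.

Lemma long_paths_sum n (I : Type) (s : seq I) (P : pred I) (G : I -> KQ) :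
  (forall i, P i -> long_paths n (G i)) -> long_paths n (\sum_(i <- s | P i) G i).
Proof. by move=> H; apply: big_ind => //; [exact: long_paths0|exact: long_pathsD]. Qed.

Lemma long_paths_basis n q : (n <= size (val q).2)%N -> long_paths n (pbasis q).
Proof. by move=> nq r; rewrite pbasisE; case: (eqVneq q r) => [<- //|_]; rewrite eqxx. Qed.

Lemma long_pathsM n k x y :
  long_paths n x -> long_paths k y -> long_paths (n + k) (x * y).
Proof.
move=> xn yk; rewrite (pexpand x) (pexpand y) mulr_suml.
rewrite big_seq; apply: long_paths_sum => q; rewrite -mcoeff_neq0 => /xn qn.
rewrite mulr_sumr big_seq; apply: long_paths_sum => r; rewrite -mcoeff_neq0 => /yk rk.
rewrite -scalerAl -scalerAr; do 2!apply: long_pathsZ; rewrite pbasisM.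
case E: (qpath_cat q r) => [s|]; last exact: long_paths0.
by apply: long_paths_basis; rewrite (qpath_cat_size E) leq_add.
Qed.

Lemma long_paths_ideal n : ideal (long_paths n).
Proof.
split=> [|a x xn]; last by apply: (@long_pathsM 0).
split=> [|x y|x a xn]; [exact: long_paths0|exact: long_pathsD|].
by rewrite -[n]addn0; apply: long_pathsM.
Qed.

Lemma long_pathsP n x : long_paths n x ->
  forall J, ideal J -> (forall q, (n <= size (val q).2)%N -> J (pbasis q)) -> J x.
Proof.
move=> xn J idJ Jq; rewrite (pexpand x); apply: ideal_sum => // q.
by rewrite -mcoeff_neq0 => /xn nq _; apply: idealZ => //; apply: Jq.
Qed.

Lemma qpath_rcons q n : size (val q).2 = n.+1 -> exists q' a,
  [/\ size (val q').2 = n, size (val a).2 = 1%N & pbasis q' * pbasis a = pbasis q].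
Proof.
case: q => -[v s] /= vP; case/lastP: s vP => // s a vP; rewrite size_rcons => -[sn].
have vP' := vP; rewrite -cats1 composable_cat /= in vP'; case/and3P: vP' => vs sa _.
exists (@QPath Q (v, s) vs); have aP : composable (source a) [:: a] by rewrite /= eqxx.
exists (@QPath Q (source a, [:: a]) aP); split=> //.
by apply: pbasis_cat; [exact/esym/eqP | rewrite /= cats1].
Qed.

Lemma arrow_idealE x : arrow_ideal x <-> long_paths 1 x.
Proof.
split=> [|x1 J idJ Jarr].
  apply; first exact: long_paths_ideal.
  by move=> _ [q q1 ->]; apply: long_paths_basis; rewrite q1.
apply: (long_pathsP x1) => // q; case E: (size _) => [//|n] _.
have [q' [a [_ a1 <-]]] := qpath_rcons E.
by apply: (idealMl idJ); apply: Jarr; exists a.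
Qed.

(** Splitting off the last arrow of a path gives the inductive step. [J] is kept general to cover
    both the arrow ideal and the Jacobson radical. *)
Lemma ideal_exp_long (J : KQ -> Prop) n x : (forall y, J y <-> long_paths 1 y) ->
  ideal_exp J n x <-> long_paths n x.
Proof.
move=> JE; elim: n x => [|n IH] x /=; first by split.
split=> [[s sP ->]|].
  rewrite big_seq; apply: long_paths_sum => u /sP[/IH un /JE u1].
  by rewrite -addn1; apply: long_pathsM.
move=> xn; rewrite (pexpand x).
have H q : q \in enum_fset (msupp x) -> exists u : KQ * KQ,
    [/\ ideal_exp J n u.1, J u.2 & x@_q *: pbasis q = u.1 * u.2].
  rewrite -[_ \in _]/(q \in msupp x) -mcoeff_neq0 => /xn.
  case E: (size _) => [//|k] nk.
  have [q' [a [q'k a1 <-]]] := qpath_rcons E.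
  exists (x@_q *: pbasis q', pbasis a); split=> /=; last exact: scalerAl.
    by apply/IH/long_pathsZ/long_paths_basis; rewrite q'k.
  by apply/JE/long_paths_basis; rewrite a1.
elim: (enum_fset (msupp x)) H => [|q s IHs] H; first by exists [::]; rewrite ?big_nil.
have [|s' s'P s'E] := IHs; first by move=> r rs; apply: H; rewrite in_cons rs orbT.
have [|u [u1 u2 uE]] := H q; first by rewrite in_cons eqxx.
exists (u :: s'); last by rewrite !big_cons s'E uE.
by move=> u'; rewrite in_cons => /orP[/eqP->|/s'P].
Qed.
End PathAlgebraGeneral.

(** * Paths of an unrolled quiver *)

(* Positions on the universal cover of a linear ([un_per = 0]) or cyclic      *)
(* quiver; in the linear case [un_ok] bounds the positions.                   *)
Record unrolling (Q : quiver) := Unrolling {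
  un_per : nat;
  un_ok : pred nat;
  un_v : nat -> vertex Q;
  un_a : nat -> arrow Q;
  un_ok_le : forall i j, (i <= j)%N -> un_ok j -> un_ok i;
  un_src : forall i, un_ok i.+1 -> source (un_a i) = un_v i;
  un_tgt : forall i, un_ok i.+1 -> target (un_a i) = un_v i.+1;
  un_uniq : forall i a, un_ok i -> source a = un_v i -> un_ok i.+1 /\ a = un_a i;
  un_cover : forall v, exists2 j, un_ok j & v = un_v j;
  un_eq : forall i j, un_ok i -> un_ok j ->
    (un_v i == un_v j) = (i == j %[mod un_per]) }.

Section Unrolling.
Variables (K : fieldType) (Q : quiver) (U : unrolling Q).
Local Notation KQ := (path_algebra K Q).
Local Notation ok := (un_ok U).
Local Notation pv := (un_v U).
Local Notation pa := (un_a U).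
Local Notation per := (un_per U).
Local Notation pb := (pbasis K).

(* A trivial path when [w] is not a position. *)
Definition pth j w : qpath Q :=
  insubd (trivial_path (pv j)) (pv j, [seq pa i | i <- iota j (w - j)]).

Lemma un_composable j k : ok (j + k)%N -> composable (pv j) [seq pa i | i <- iota j k].
Proof.
elim: k j => //= k IH j jk.
have j1 : ok j.+1 by apply: un_ok_le jk; rewrite addnS ltnS leq_addr.
by rewrite un_src // eqxx un_tgt //= IH // addSnnS.
Qed.

Lemma un_last j k : ok (j + k)%N ->
  last (pv j) [seq target a | a <- [seq pa i | i <- iota j k]] = pv (j + k)%N.
Proof.
elim: k j => [|k IH] j; first by rewrite addn0.
move=> jk; rewrite /= un_tgt; last by apply: un_ok_le jk; rewrite addnS ltnS leq_addr.
by rewrite IH addSnnS.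
Qed.

Lemma val_pth j w : (j <= w)%N -> ok w ->
  val (pth j w) = (pv j, [seq pa i | i <- iota j (w - j)]).
Proof. by move=> jw w1; rewrite insubdK //; apply: un_composable; rewrite subnKC. Qed.

Lemma pth_src j w : qpath_src (pth j w) = pv j.
Proof. by rewrite /qpath_src val_insubd; case: ifP. Qed.

Lemma pth_size j w : (j <= w)%N -> ok w -> size (val (pth j w)).2 = (w - j)%N.
Proof. by move=> jw w1; rewrite val_pth // size_map size_iota. Qed.

Lemma pth_tgt j w : (j <= w)%N -> ok w -> qpath_tgt (pth j w) = pv w.
Proof. by move=> jw w1; rewrite /qpath_tgt val_pth //= un_last subnKC. Qed.

Lemma pth_cat j i w : (j <= i <= w)%N -> ok w -> pb (pth j i) * pb (pth i w) = pb (pth j w).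
Proof.
move=> /andP[ji iw] w1; have i1 : ok i := un_ok_le iw w1.
apply: pbasis_cat; first by rewrite pth_tgt ?pth_src.
rewrite pth_src !val_pth //=; last exact: leq_trans iw.
by rewrite -map_cat -{2}(subnKC ji) -iotaD addnC addnBA // subnK.
Qed.

(** At most one arrow leaves each vertex, so a path is determined by its source and its length. *)
Lemma path_is_pth q j : ok j -> qpath_src q = pv j ->
  ok (j + size (val q).2)%N /\ q = pth j (j + size (val q).2)%N.
Proof.
move=> j1 qj; suff H s i : ok i -> composable (pv i) s ->
    ok (i + size s)%N /\ s = [seq pa k | k <- iota i (size s)].
  have cq : composable (pv j) (val q).2 by rewrite -qj; apply: (valP q).
  have [ok1 sE] := H _ _ j1 cq.
  split=> //; apply: val_inj; rewrite val_pth ?leq_addr // addKn -sE -qj.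
  by rewrite /qpath_src; case: (val q).
elim: s i => [|a s IH] i i1 /=; first by rewrite addn0.
case/andP=> /eqP ai; have [i2 aE] := un_uniq i1 ai; rewrite aE un_tgt // => cs.
have [okk sE] := IH _ i2 cs.
by split; [rewrite -addSnnS | congr cons].
Qed.

Lemma pth_shift i j k : ok i -> ok j -> i = j %[mod per] -> ok (j + k)%N ->
  ok (i + k)%N /\ pth i (i + k)%N = pth j (j + k)%N.
Proof.
move=> i1 j1 ij jk; have ij' : pv j = pv i by apply/eqP; rewrite un_eq // eq_sym; apply/eqP.
have := @path_is_pth (pth j (j + k)%N) i i1; rewrite pth_src => /(_ ij').
by rewrite pth_size ?leq_addr // addKn => -[? ->].
Qed.

Lemma pth_inj j w w' : (j <= w)%N -> (j <= w')%N -> ok w -> ok w' ->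
  (pth j w == pth j w') = (w == w').
Proof.
move=> jw jw' w1 w1'; apply/eqP/eqP => [/(congr1 (fun q => size (val q).2))|-> //].
by rewrite !pth_size //; lia.
Qed.

Lemma pth_end_inj j j' w : (j <= w)%N -> (j' <= w)%N -> ok w ->
  (pth j w == pth j' w) = (j == j').
Proof.
move=> jw jw' w1; apply/eqP/eqP => [/(congr1 (fun q => size (val q).2))|-> //].
by rewrite !pth_size //; lia.
Qed.

(** By bilinearity [x] and [y] may be basis paths [q] and [r]; the path from [j] to [w] is their
    product for a single cut point, [j] plus the length of [q]. *)
Lemma coef_pthM (x y : KQ) j w : (j <= w)%N -> ok w ->
  (x * y)@_(pth j w) = \sum_(j <= i < w.+1) x@_(pth j i) * y@_(pth i w).
Proof.
move=> jw w1; move: x; apply: (@plinear_ext K Q K^o) => [a u v|a u v|q].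
- by rewrite mulrDl -scalerAl mcoeffD mcoeffZ.
- rewrite scaler_sumr -big_split /=; apply: eq_bigr => i _.
  by rewrite mcoeffD mcoeffZ mulrDl -mulrA.
move: y; apply: (@plinear_ext K Q K^o) => [a u v|a u v|r].
- by rewrite mulrDr -scalerAr mcoeffD mcoeffZ.
- rewrite scaler_sumr -big_split /=; apply: eq_bigr => i _.
  by rewrite mcoeffD mcoeffZ mulrDr mulrCA.
have okle i : (i <= w)%N -> ok i by move=> iw; apply: un_ok_le iw w1.
rewrite (eq_big_nat _ _ (F2 := fun i => ((q == pth j i) && (r == pth i w))%:R)); last first.
  by move=> i _; rewrite !pbasisE -natrM mulnb.
case E: (qpath_cat q r) => [s|]; last first.
  rewrite pbasisM E mcoeff0 big_nat_cond big1 // => i /andP[/andP[ji iw] _].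
  case: eqP => //= qE; case: eqP => //= rE; move: E; rewrite qE rE.
  have [|s -> //] := @qpath_catP _ (pth j i) (pth i w).
  by rewrite pth_tgt ?pth_src // okle.
rewrite pbasisM E pbasisE; case: eqP => [sE|sN]; last first.
  rewrite big_nat_cond big1 // => i /andP[/andP[ji iw] _].
  case: eqP => //= qE; case: eqP => //= rE; case: sN; move: E.
  have := @pth_cat j i w; rewrite ji -ltnS iw => /(_ isT w1).
  rewrite pbasisM -qE -rE => + E; rewrite E.
  exact: pbasis_inj.
have qr : qpath_tgt q = qpath_src r.
  by apply/eqP; apply: contraT => /qpath_catN; rewrite E.
have [s' s'1 s'2] := qpath_catP qr; have {s'1}ss' : s = s' by move: s'1; rewrite E => -[].
have j1 : ok j := okle _ jw.
have qsrc : qpath_src q = pv j by rewrite -(pth_src j w) -sE ss' {2}/qpath_src s'2.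
have [q1 qE] := path_is_pth j1 qsrc; set k := (j + _)%N in q1 qE.
have rsrc : qpath_src r = pv k by rewrite -qr qE pth_tgt // leq_addr.
have [r1 rE] := path_is_pth q1 rsrc.
have kw : (k + size (val r).2)%N = w.
  have := qpath_cat_size E; rewrite sE pth_size // /k; lia.
rewrite kw in rE; have kle : (k <= w)%N by rewrite -kw leq_addr.
rewrite (@big_nat_restrict _ _ j w.+1 k k.+1 (leq_addr _ _) kle) ?big_nat1.
  by rewrite -qE -rE !eqxx.
move=> i /andP[ji iw]; rewrite ltnS -eqn_leq => ki.
by rewrite qE pth_inj ?leq_addr ?(negPf ki) // okle.
Qed.

(** * The Kupisch function of an admissible quotient *)

Section Data.
Variables (L : algType K) (J : KQ -> Prop) (F : {lrmorphism KQ -> L}).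
Hypotheses (admJ : admissible J) (F_surj : forall y, exists x, F x = y)
  (F_ker : forall x, F x = 0 <-> J x).

Let idJ : ideal J. Proof. by case: admJ. Qed.
Local Notation V q := (J (pb q)).

Lemma long_in_J : exists t, forall q : qpath Q, (t <= size (val q).2)%N -> V q.
Proof.
case: admJ => _ _ [t _ Jt]; exists t => q tq; apply: Jt.
apply/ideal_exp_long; last exact: long_paths_basis.
exact: arrow_idealE.
Qed.

Lemma short_notin_J (q : qpath Q) : V q -> (2 <= size (val q).2)%N.
Proof.
case: admJ => _ J2 _ /J2/(ideal_exp_long _ _ (@arrow_idealE K Q)); apply.
by rewrite pbasisE eqxx oner_neq0.
Qed.

Definition stop j w := ~~ ok w || `[< V (pth j w) >].

Lemma stop_exists j : exists k, stop j (j + k).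
Proof.
have [t Jt] := long_in_J; exists t; rewrite /stop; case: (boolP (ok _)) => //= jt.
by apply/asboolP/Jt; rewrite pth_size ?leq_addr // addKn.
Qed.

(** The Kupisch function: the search for the first stop succeeds because [J] contains all
    sufficiently long paths. *)
Definition loewy_end j := (j + ex_minn (stop_exists j))%N.
Local Notation p := loewy_end.

Lemma loewy_end_ge j : (j <= p j)%N. Proof. exact: leq_addr. Qed.

Lemma loewy_end_stop j : stop j (p j).
Proof. by rewrite /loewy_end; case: ex_minnP. Qed.

Lemma loewy_end_le j w : (j <= w)%N -> stop j w -> (p j <= w)%N.
Proof.
move=> jw sw; rewrite /loewy_end; case: ex_minnP => k _ /(_ (w - j)%N).
by rewrite subnKC // => /(_ sw); lia.
Qed.

Lemma lt_loewy_end j w : (j <= w < p j)%N -> ok w /\ ~ V (pth j w).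
Proof.
move=> /andP[jw wp]; have: ~~ stop j w.
  by apply/negP => /(loewy_end_le jw); rewrite leqNgt wp.
by rewrite /stop negb_or negbK => /andP[w1 /asboolPn].
Qed.

Lemma ge_loewy_end j w : (p j <= w)%N -> ok w -> V (pth j w).
Proof.
move=> pw w1; rewrite -(@pth_cat j (p j)) ?loewy_end_ge //.
apply: idealMr => //; have := loewy_end_stop j.
by rewrite /stop (un_ok_le pw w1) /= => /asboolP.
Qed.

(** [J] is a left ideal: a path in [J] stays in [J] when its start moves back by one arrow. *)
Lemma loewy_end_mono u v : (u <= v)%N -> (p u <= p v)%N.
Proof.
elim: v => [|v IH]; first by rewrite leqn0 => /eqP->.
rewrite leq_eqVlt => /predU1P[-> //|/IH/leq_trans]; apply.
have vp := loewy_end_ge v.+1; apply: loewy_end_le; first exact: ltnW.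
have [w1|wN] := boolP (ok (p v.+1)); last by rewrite /stop wN.
have := loewy_end_stop v.+1; rewrite /stop w1 => /asboolP Vp.
apply/asboolP; rewrite -(@pth_cat v v.+1) //; last by rewrite leqnSn.
exact: idealMl.
Qed.

Lemma loewy_end_out u : ~~ ok u -> p u = u.
Proof.
by move=> uN; apply/eqP; rewrite eqn_leq loewy_end_ge loewy_end_le // /stop uN.
Qed.

Lemma loewy_end_ge2 u : ok u.+1 -> (u.+2 <= p u)%N.
Proof.
move=> u1; rewrite ltnNge; apply/negP => pu.
by have /short_notin_J := ge_loewy_end pu u1; rewrite pth_size ?leqnSn // subSnn.
Qed.

Lemma loewy_end_per u : (forall i, ok i) -> p (u + per)%N = (p u + per)%N.
Proof.
move=> okT; have st w : (u <= w)%N -> stop (u + per)%N (w + per)%N = stop u w.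
  move=> uw; rewrite /stop !okT /= -(subnKC uw) -addnAC; congr (`[< V _ >]).
  by apply: (pth_shift _ _ _ _).2; rewrite // modnDr.
apply/eqP; rewrite eqn_leq; apply/andP; split.
  apply: loewy_end_le; first by rewrite leq_add2r loewy_end_ge.
  by rewrite st ?loewy_end_ge ?loewy_end_stop.
have le := loewy_end_ge (u + per)%N.
have uw : (u <= p (u + per) - per)%N by lia.
suff: (p u <= p (u + per) - per)%N by lia.
apply: loewy_end_le => //; rewrite -st // subnK; last by lia.
exact: loewy_end_stop.
Qed.

(* [J] is a monomial ideal: multiply [x] on the right by the path that takes  *)
(* its shortest term starting at [j] to a socle path; the other terms vanish. *)
Lemma J_coef x j w : J x -> (j <= w < p j)%N -> x@_(pth j w) = 0.
Proof.
move=> Jx jwp; have [w1 _] := lt_loewy_end jwp; have /andP[jw wp] := jwp.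
apply/eqP; apply: contraT => xw.
have ex : exists u, (j <= u)%N && (x@_(pth j u) != 0) by exists w; rewrite jw.
have [u /andP[ju xu] umin] := ex_minnP ex.
have uw : (u <= w)%N by apply: umin; rewrite jw.
have u1 : ok u := un_ok_le uw w1; have j1 : ok j := un_ok_le jw w1.
(* [e] is the socle of the projective at [j], the last position with a nonzero path from [j]. *)
have [e pje] : exists e, p j = e.+1 by exists (p j).-1; rewrite (ltn_predK wp).
have we : (w <= e)%N by rewrite -ltnS -pje.
have ue := leq_trans uw we; have je := leq_trans jw we.
have [|e1 eV] := @lt_loewy_end j e; first by rewrite pje ltnS leqnn andbT.
have Jz : J (pb (pth j j) * x * pb (pth u e)) by apply: idealMr => //; apply: idealMl.
case: eV; move: Jz; rewrite {1}(pexpand x) mulr_sumr mulr_suml.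
have um : pth j u \in enum_fset (msupp x).
  by rewrite -[_ \in _]/(pth j u \in msupp x) -mcoeff_neq0.
rewrite (bigD1_seq (pth j u) um (fset_uniq _)) /=.
set s := (X in _ + X) => Jz.
have Js : J s.
  apply: ideal_sum => // q; rewrite -[_ \in _]/(q \in msupp x) -mcoeff_neq0 => xq qu.
  rewrite -scalerAr -scalerAl; apply: idealZ => //.
  have [qj|qj] := eqVneq (qpath_src q) (pv j); last first.
    rewrite pbasisM0 ?mul0r; last by rewrite pth_tgt // eq_sym.
    exact: ideal0.
  have [v1 qE] := path_is_pth j1 qj; set v := (j + _)%N in v1 qE.
  have jv : (j <= v)%N by apply: leq_addr.
  rewrite qE pth_cat ?leqnn //.
  have [vu|vu] := eqVneq (pv v) (pv u); last first.
    by rewrite pbasisM0 ?pth_tgt ?pth_src //; apply: ideal0.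
  (* Another term that survives both products ends at some [v > u] over the same vertex as [u]; the
     product then runs past [e] and lies in [J]. *)
  have uv : (u < v)%N.
    rewrite ltn_neqAle umin ?jv -?qE // andbT; apply: contraNneq qu => uv.
    by rewrite qE uv.
  have uvE : v = u %[mod per] by apply/eqP; rewrite -un_eq // vu.
  have := @pth_shift v u (e - u)%N v1 u1 uvE; rewrite subnKC // => /(_ e1)[ve1 <-].
  rewrite pth_cat ?jv ?leq_addr //; apply: ge_loewy_end => //.
  by rewrite pje -{1}(subnKC ue) -addSn leq_add2r.
have : J (x@_(pth j u) *: pb (pth j e)).
  have -> : x@_(pth j u) *: pb (pth j e) =
      pb (pth j j) * (x@_(pth j u) *: pb (pth j u)) * pb (pth u e) + s + (-1) *: s.
    by rewrite scaleN1r addrK -scalerAr -scalerAl !pth_cat ?leqnn ?ju.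
  by apply: idealD => //; apply: idealZ.
move/(idealZ idJ (x@_(pth j u))^-1); rewrite scalerA mulVf // scale1r.
exact.
Qed.

Definition F_inv y := sval (cid (F_surj y)).
Lemma F_invK y : F (F_inv y) = y. Proof. exact: svalP (cid (F_surj y)). Qed.

(** Inside [[j, p j)] the value does not depend on the chosen preimage, by [J_coef]. *)
Definition L_coef_fun j w y : K := if (j <= w < p j)%N then (F_inv y)@_(pth j w) else 0.

Lemma L_coef_F j w x : (j <= w < p j)%N -> L_coef_fun j w (F x) = x@_(pth j w).
Proof.
move=> jwp; rewrite /L_coef_fun jwp; apply/eqP; rewrite -subr_eq0 -mcoeffB.
by apply/eqP/J_coef => //; apply/F_ker; rewrite linearB /= F_invK subrr.
Qed.

Lemma L_coef_linear j w : linear_for *%R (L_coef_fun j w).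
Proof.
move=> a u v; have [jwp|jwN] := boolP (j <= w < p j)%N; last first.
  by rewrite /L_coef_fun (negPf jwN) mulr0 addr0.
rewrite -(F_invK u) -(F_invK v) -linearP !L_coef_F //.
by rewrite mcoeffD mcoeffZ.
Qed.

Definition L_coef j w : {scalar L} :=
  HB.pack (L_coef_fun j w) (GRing.isLinear.Build _ _ _ _ _ (L_coef_linear j w)).

Lemma L_coefE j w x : (j <= w < p j)%N -> L_coef j w (F x) = x@_(pth j w).
Proof. exact: L_coef_F. Qed.

Lemma L_coef_fun_F j w a x y : L_coef_fun j w (F (a *: x + y)) =
  a * L_coef_fun j w (F x) + L_coef_fun j w (F y).
Proof. by rewrite linearP; apply: L_coef_linear. Qed.

Lemma L_coef_low j w y : (w < j)%N -> L_coef j w y = 0.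
Proof. by move=> wj; rewrite /L_coef /= /L_coef_fun leqNgt wj. Qed.

Lemma L_coef1 j w : (j <= w < p j)%N -> L_coef j w 1 = (j == w)%:R.
Proof.
move=> jwp; have [w1 _] := lt_loewy_end jwp; have /andP[jw _] := jwp.
have j1 := un_ok_le jw w1; rewrite -(rmorph1 F) L_coefE //.
rewrite -[1 : KQ]/(pa_one K Q) /pa_one raddf_sum /= (bigD1 (pv j)) //=.
rewrite big1 ?addr0 => [|v vj].
  rewrite -/(pbasis K (trivial_path (pv j))) pbasisE; congr (_%:R).
  have -> : trivial_path (pv j) = pth j j.
    by apply: val_inj; rewrite val_pth // subnn.
  by rewrite pth_inj.
rewrite -/(pbasis K (trivial_path v)) pbasisE; case: eqP => // vE; case/eqP: vj.
by rewrite -(pth_src j w) -vE.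
Qed.

Lemma L_coefM j w y z : (w < p j)%N ->
  L_coef j w (y * z) = \sum_(j <= i < w.+1) L_coef j i y * L_coef i w z.
Proof.
move=> wp; have [jw|wj] := leqP j w; last by rewrite big_geq // L_coef_low.
have jwp : (j <= w < p j)%N by rewrite jw.
have [w1 _] := lt_loewy_end jwp.
rewrite -(F_invK y) -(F_invK z) -rmorphM L_coefE // coef_pthM //.
apply: eq_big_nat => i /andP[ji]; rewrite ltnS => iw; rewrite !L_coefE //.
  by rewrite iw (leq_trans wp) // loewy_end_mono.
by rewrite ji (leq_ltn_trans iw).
Qed.

(** The explicit 0 matters: [pth u w] is a trivial path, not in [J], once [w] is beyond the last
    position. *)
Definition L_path u w : L := if (u <= w < p u)%N then F (pb (pth u w)) else 0.

Lemma L_coef_col j u w : (j <= w < p j)%N -> (u <= w)%N ->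
  L_coef j w (L_path u w) = (j == u)%:R.
Proof.
move=> jwp uw; have [w1 _] := lt_loewy_end jwp; have /andP[jw wp] := jwp.
rewrite /L_path uw; case: ltnP => [wu|up].
  by rewrite L_coefE // pbasisE pth_end_inj // eq_sym.
by rewrite linear0; case: eqP => // ju; move: up; rewrite -ju leqNgt wp.
Qed.

Lemma L_coef_row u w w' : (u <= w < p u)%N -> (u <= w' < p u)%N ->
  L_coef u w (L_path u w') = (w == w')%:R.
Proof.
move=> uwp uwp'; have [[w1 _] [w1' _]] := (lt_loewy_end uwp, lt_loewy_end uwp').
have [/andP[uw _] /andP[uw' _]] := (uwp, uwp').
by rewrite /L_path uwp' L_coefE // pbasisE pth_inj // eq_sym.
Qed.

Lemma L_row u y : L_path u u * y = \sum_(u <= w < p u) L_coef u w y *: L_path u w.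
Proof.
have [u1|uN] := boolP (ok u); last first.
  by rewrite /L_path loewy_end_out // ltnn andbF mul0r big_geq.
have up : (u <= u < p u)%N.
  rewrite leqnn ltnNge; apply/negP => pu.
  by have /short_notin_J := ge_loewy_end pu u1; rewrite pth_size // subnn.
rewrite -(F_invK y); move: (F_inv y); apply: plinear_ext => [a v w|a v w|q].
- by rewrite linearP mulrDr scalerAr.
- rewrite scaler_sumr -big_split; apply: eq_bigr => i _ /=.
  by rewrite L_coef_fun_F scalerDl scalerA.
rewrite /L_path up -rmorphM.
under eq_big_nat => w uwp do rewrite L_coefE // uwp pbasisE.
have [qu|qu] := eqVneq (qpath_src q) (pv u); last first.
  rewrite pbasisM0; last by rewrite pth_tgt // eq_sym.
  rewrite rmorph0 big1 // => w _.
  by case: eqP => [qE|]; rewrite ?scale0r //; case/eqP: qu; rewrite qE pth_src.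
have [v1 qE] := path_is_pth u1 qu; set v := (u + _)%N in v1 qE.
have uv : (u <= v)%N by apply: leq_addr.
rewrite {1}qE pth_cat ?leqnn ?uv //; have [vp|pv] := ltnP v (p u).
  rewrite (@big_nat_restrict _ _ u (p u) v v.+1 uv vp) ?big_nat1.
    by rewrite qE eqxx scale1r.
  move=> w /andP[uw wp]; rewrite ltnS -eqn_leq => vw.
  have [|w1 _] := @lt_loewy_end u w; first by rewrite uw.
  by rewrite qE pth_inj // (negPf vw) scale0r.
transitivity (0 : L); first exact/F_ker/ge_loewy_end.
rewrite big_nat_cond big1 // => w /andP[/andP[uw wp] _].
have [|w1 _] := @lt_loewy_end u w; first by rewrite uw.
by rewrite qE pth_inj // gtn_eqF ?scale0r // (leq_trans wp).
Qed.

(** For a basis path [q] ending at [w]: if it starts at or after [a], it contributes a single term;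
    if it is longer, its product with the path to [b.-1] contains the path from [a.-1] to [b.-1],
    which is in [J]. *)
Lemma L_col a b w y :
  [&& (a < b)%N, (b <= p a)%N & if a is a'.+1 then (p a' < b)%N else per == 0%N] ->
  (a <= w < b)%N -> y * L_path w b.-1 = \sum_(a <= j < b) L_coef j w y *: L_path j b.-1.
Proof.
move=> /and3P[ab bp start] /andP[aw wb].
have b0 : (0 < b)%N by apply: leq_trans wb.
have b1 : (b.-1 < b)%N by rewrite prednK.
have le_b1 j : (j < b)%N -> (j <= b.-1)%N by lia.
have jb j : (a <= j < b)%N -> (j <= b.-1 < p j)%N.
  move=> /andP[aj jb]; rewrite le_b1 //.
  by apply: leq_trans b1 (leq_trans bp _); apply: loewy_end_mono.
have [|ok1 _] := @lt_loewy_end a b.-1; first by rewrite jb ?leqnn.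
have w1 : ok w := un_ok_le (le_b1 _ wb) ok1.
rewrite -(F_invK y); move: (F_inv y); apply: plinear_ext => [c v v'|c v v'|q].
- by rewrite linearP mulrDl scalerAl.
- rewrite scaler_sumr -big_split; apply: eq_bigr => i _ /=.
  by rewrite L_coef_fun_F scalerDl scalerA.
have coefq j : (a <= j < b)%N -> L_coef j w (F (pb q)) = ((j <= w)%N && (q == pth j w))%:R.
  move=> /andP[aj jb']; have [jw|wj] := leqP j w; last by rewrite L_coef_low.
  by rewrite L_coefE ?pbasisE // jw (leq_ltn_trans (le_b1 _ wb)) // (andP (jb j _)).2 ?aj.
rewrite {1}/L_path jb ?aw // -rmorphM.
have [qw|qw] := eqVneq (qpath_tgt q) (pv w); last first.
  rewrite pbasisM0 ?pth_src // rmorph0 big_nat_cond big1 // => j /andP[ab' _].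
  rewrite coefq //; case: leqP => [jw|_]; rewrite ?scale0r //=.
  by case: eqP => [qE|]; rewrite ?scale0r //; case/eqP: qw; rewrite qE pth_tgt.
have [j0 j01 qj0] := un_cover U (qpath_src q).
have [k1 qE] := path_is_pth j01 qj0; set k := size _ in k1 qE.
have kw : (j0 + k)%N = w %[mod per].
  by apply/eqP; rewrite -un_eq // -qw {1}qE pth_tgt ?leq_addr.
have [kaw|kaw] := leqP k (w - a).
  have kw' : (k <= w)%N by apply: leq_trans kaw (leq_subr _ _).
  have wk1 : ok (w - k)%N by apply: un_ok_le w1; apply: leq_subr.
  have wkE : (w - k)%N = j0 %[mod per].
    by apply/eqP; rewrite -(eqn_modDr k) subnK // eq_sym kw.
  have [_ qE'] := pth_shift wk1 j01 wkE k1; rewrite -qE subnK // in qE'.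
  have ak : (a <= w - k)%N by clear -kaw aw; lia.
  have kb : (w - k < b)%N by apply: leq_ltn_trans wb; apply: leq_subr.
  rewrite (@big_nat_restrict _ _ a b (w - k) (w - k).+1 ak kb) ?big_nat1.
    rewrite coefq ?ak // leq_subr qE' eqxx scale1r /L_path jb ?ak //.
    by rewrite -qE' pth_cat // leq_subr le_b1.
  move=> j /andP[aj jb']; rewrite ltnS -eqn_leq => jN; rewrite coefq ?aj //.
  case: leqP => [jw|]; rewrite ?scale0r //= -qE' pth_end_inj ?leq_subr //.
  by rewrite (negPf jN) scale0r.
(* For [a = 0] the period is 0, so no path ending at [w] is longer than [w]. *)
case: a ab bp start aw jb coefq kaw => [|a'] ab bp start aw jb coefq kaw.
  by move: kw kaw; rewrite (eqP start) !modn0 subn0 => <-; rewrite ltnNge leq_addl.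
transitivity (0 : L).
  apply/F_ker.
  (* The position over [a'] on the lift of [q] that starts at [j0]. *)
  pose i := (j0 + k - (w - a'))%N.
  have i1 : ok i by apply: un_ok_le k1; apply: leq_subr.
  have aw' := ltnW aw; have a'1 : ok a' := un_ok_le aw' w1.
  rewrite subnSK // in kaw.
  have wa : (w - a' <= j0 + k)%N by apply: leq_trans kaw (leq_addl _ _).
  have iE : i = a' %[mod per].
    by apply/eqP; rewrite -(eqn_modDr (w - a')) subnK // subnKC // kw.
  have [|_ sE] := @pth_shift i a' (w - a')%N i1 a'1 iE; first by rewrite subnKC.
  rewrite subnK // subnKC // in sE.
  rewrite qE -(@pth_cat j0 i (j0 + k)) //; last first.
    by rewrite leq_subr andbT /i -addnBA ?leq_addr.
  rewrite sE -mulrA pth_cat //; last by rewrite le_b1 ?andbT.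
  by apply: idealMl => //; apply: ge_loewy_end => //; apply: le_b1.
apply/esym; rewrite big_nat_cond big1 // => j /andP[/andP[aj jb'] _].
rewrite coefq ?aj //; case: leqP => [jw|]; rewrite ?scale0r //=.
case: eqP => [qE'|]; rewrite ?scale0r //.
have := pth_size jw w1; rewrite -qE' -/k => kwj.
by move: kaw; rewrite kwj ltnNge leq_sub2l.
Qed.

Definition unrolled_data : nakayama_data L :=
  @NakayamaData K L loewy_end L_coef L_path (per == 0%N)
    loewy_end_ge loewy_end_mono L_coef_low L_coef1 L_coefM L_coef_col L_coef_row
    L_row L_col.
End Data.
End Unrolling.

(** * Unrolling the linear quiver and the oriented cycle *)

(** Arrows lower the ordinals while positions increase, whence the reversal [m.+1 - i]. Congruence
    modulo the period 0 is equality. *)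
Lemma linear_unrolling m : exists U : unrolling (linear_quiver m.+2),
  un_per U = 0%N /\ un_ok U = [pred w | (w < m.+2)%N].
Proof.
pose v i : vertex (linear_quiver m.+2) := inord (m.+1 - i) : 'I_m.+2.
pose a i : arrow (linear_quiver m.+2) := inord (m - i) : 'I_m.+1.
have vE i : v i = (m.+1 - i)%N :> nat by apply: inordK; rewrite ltnS leq_subr.
have aE i : a i = (m - i)%N :> nat by apply: inordK; rewrite ltnS leq_subr.
have ok_le i j : (i <= j)%N -> [pred w | (w < m.+2)%N] j -> [pred w | (w < m.+2)%N] i.
  exact: leq_ltn_trans.
have src i : [pred w | (w < m.+2)%N] i.+1 -> source (a i) = v i.
  by rewrite /= !ltnS => im; apply: val_inj; rewrite /= /bump leq0n vE aE add1n subSn.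
have tgt i : [pred w | (w < m.+2)%N] i.+1 -> target (a i) = v i.+1.
  by move=> _; apply: val_inj; rewrite [RHS]vE; apply: etrans (aE i) _; rewrite subSS.
have uniq i b : [pred w | (w < m.+2)%N] i -> source b = v i ->
    [pred w | (w < m.+2)%N] i.+1 /\ b = a i.
  rewrite /= ltnS => im /(congr1 val) /=; rewrite vE /bump leq0n add1n => bE.
  by split; [lia | apply: val_inj; rewrite [RHS]aE /=; lia].
have cover w : exists2 j, [pred w | (w < m.+2)%N] j & w = v j.
  have wm : (w < m.+2)%N := ltn_ord w.
  exists (m.+1 - w)%N; first by rewrite /= ltnS leq_subr.
  by apply: val_inj; rewrite [RHS]vE subKn.
have eqv i j : [pred w | (w < m.+2)%N] i -> [pred w | (w < m.+2)%N] j ->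
    (v i == v j) = (i == j %[mod 0]).
  rewrite /= !ltnS !modn0 => im jm.
  have -> : (v i == v j) = (v i == v j :> nat) by [].
  rewrite !vE.
  by apply/eqP/eqP => [|-> //]; lia.
by exists (Unrolling ok_le src tgt uniq cover eqv).
Qed.

Lemma cyclic_unrolling n : exists U : unrolling (cyclic_quiver n),
  un_per U = n.+1 /\ un_ok U = predT.
Proof.
pose v i : 'I_n.+1 := inord (i %% n.+1).
have vE i : v i = (i %% n.+1)%N :> nat by apply: inordK; rewrite ltn_mod.
have ok_le i j : (i <= j)%N -> predT j -> predT i by [].
have src i : predT i.+1 -> @source (cyclic_quiver n) (v i) = v i by [].
have tgt i : predT i.+1 -> @target (cyclic_quiver n) (v i) = v i.+1.
  move=> _; have H : ((v i).+1 %% n.+1 = v i.+1)%N.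
    by rewrite !vE -[in LHS]addn1 modnDml addn1.
  by apply: val_inj; apply: H.
have uniq i (b : arrow (cyclic_quiver n)) : predT i -> source b = v i ->
    predT i.+1 /\ b = v i by [].
have cover (w : vertex (cyclic_quiver n)) : exists2 j, predT j & w = v j.
  by exists (val w) => //; apply: val_inj; rewrite [RHS]vE modn_small ?ltn_ord.
have eqv i j : predT i -> predT j -> (v i == v j) = (i == j %[mod n.+1]).
  by move=> _ _; rewrite -!vE.
by exists (@Unrolling (cyclic_quiver n) _ _ v v ok_le src tgt uniq cover eqv).
Qed.

(** * The Jacobson radical when path lengths are bounded *)

Section Radical.
Variables (K : fieldType) (Q : quiver).
Local Notation KQ := (path_algebra K Q).

Lemma size0_trivial (q : qpath Q) : size (val q).2 = 0%N -> q = trivial_path (qpath_src q).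
Proof. by case: q => -[v [|//]] vP _; apply: val_inj. Qed.

Lemma coef_trivialM (x y : KQ) v :
  (x * y)@_(trivial_path v) = x@_(trivial_path v) * y@_(trivial_path v).
Proof.
move: x; apply: (@plinear_ext K Q K^o) => [a u u'|a u u'|q].
- by rewrite mulrDl -scalerAl mcoeffD mcoeffZ.
- by rewrite mcoeffD mcoeffZ mulrDl -mulrA.
move: y; apply: (@plinear_ext K Q K^o) => [a u u'|a u u'|r].
- by rewrite mulrDr -scalerAr mcoeffD mcoeffZ.
- by rewrite mcoeffD mcoeffZ mulrDr mulrCA.
rewrite pbasisM (pbasisE K q (trivial_path v)) (pbasisE K r (trivial_path v)).
rewrite -natrM mulnb.
case E: (qpath_cat q r) => [s|]; last first.
  rewrite mcoeff0; case: eqP => //= qE; case: eqP => //= rE.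
  by move: E; rewrite qE rE qpath_cat0p eqxx.
rewrite pbasisE; congr (nat_of_bool _)%:R; apply/eqP/andP => [sE|[/eqP qE /eqP rE]].
  have := qpath_cat_size E; rewrite sE => /esym/eqP; rewrite addn_eq0.
  case/andP=> /eqP/size0_trivial q0 /eqP/size0_trivial r0; move: E.
  rewrite q0 qpath_cat0p; case: eqP => // -> [] rs; split; apply/eqP; last by rewrite rs.
  by rewrite rs sE.
by move: E; rewrite qE rE qpath_cat0p eqxx => -[].
Qed.

Lemma coef1_trivial v : (1 : KQ)@_(trivial_path v) = 1.
Proof.
rewrite -[1 : KQ]/(pa_one K Q) /pa_one raddf_sum /= (bigD1 v) //=.
rewrite big1 ?addr0 => [|w wv]; first by rewrite (pbasisE K (trivial_path v)) eqxx.
rewrite (pbasisE K (trivial_path w)); case: eqP => // /(congr1 val) [wE].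
by rewrite wE eqxx in wv.
Qed.

(** The coefficient at a trivial path is an algebra morphism onto [K], so its kernel is maximal. *)
Lemma trivial_coef_maximal v :
  maximal_right_ideal (fun x : KQ => x@_(trivial_path v) = 0).
Proof.
split=> [||J [J0 JD JM] J1 IJ x Jx].
- split=> [|x y x0 y0|x a x0]; first exact: mcoeff0.
    by rewrite mcoeffD x0 y0 addr0.
  by rewrite coef_trivialM x0 mul0r.
- by move/eqP; rewrite coef1_trivial oner_eq0.
apply/eqP; apply: contraT => xv; case: J1; pose c := x@_(trivial_path v).
have -> : 1 = x * (c^-1)%:A + (1 - x * (c^-1)%:A) by rewrite addrC subrK.
apply: JD; first exact: JM.
apply: IJ; rewrite mcoeffB coef1_trivial coef_trivialM mcoeffZ coef1_trivial.
by rewrite mulr1 divff // subrr.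
Qed.

(** One inclusion tests an element against the ideals of [trivial_coef_maximal]. For the other, if
    [x] avoided a maximal [J], then [1 = z + x * a] with [z] in [J] and [x * a] nilpotent, so [z]
    would be invertible. *)
Lemma jacobson_radicalE n : (forall x : KQ, long_paths n x -> x = 0) ->
  forall x, @jacobson_radical KQ x <-> long_paths 1 x.
Proof.
move=> nil x; split=> [radx q|x1 J [[J0 JD JM] J1 Jmax]].
  case E: (size _) => // /eqP; case; move: E; case: q => -[v [|//]] qP _.
  have := radx _ (trivial_coef_maximal v); congr (_@__ = 0).
  exact: val_inj.
apply: contrapT => Jx.
have JI : forall y, (exists2 z, J z & exists a, y = z + x * a) -> J y.
  apply: Jmax.
  - split=> [|_ _ [z Jz [a ->]] [z' Jz' [a' ->]]|_ b [z Jz [a ->]]].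
    + by exists 0 => //; exists 0; rewrite mulr0 addr0.
    + exists (z + z'); first exact: JD.
      by exists (a + a'); rewrite mulrDr addrACA.
    + by exists (z * b); [exact: JM | exists (a * b); rewrite mulrDl mulrA].
  - case=> z Jz [a zE]; apply: J1.
    have xa1 : long_paths 1 (x * a) by apply: idealMr x1; apply: long_paths_ideal.
    have xan : (x * a) ^+ n = 0.
      apply: nil; elim: (n) => [//|k IH].
      by rewrite exprS -add1n; apply: long_pathsM.
    have -> : 1 = z * \sum_(i < n) (x * a) ^+ i.
      have -> : z = - (x * a - 1) by rewrite zE opprB addrK.
      have := subrX1 (x * a) n; rewrite xan sub0r => H.
      by rewrite mulNr -H opprK.
    exact: JM.
  - by move=> z Jz; exists z => //; exists 0; rewrite mulr0 addr0.
by apply: Jx; apply: JI; exists 0 => //; exists 1; rewrite mulr1 add0r.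
Qed.
End Radical.

(** * The case of one vertex *)

Section OneVertex.
Variables (K : fieldType) (L : algType K).
Hypothesis L_scalar : forall y : L, exists c : K, y = c%:A.

(** All of [L] acts through scalars of [K], so a splitting linear over [K] is linear over [L]. *)
Lemma scalar_projective (P : rmodType L) : projective P.
Proof.
move=> M N g f gs; have [s sP] := linear_ginv (linear_of (linear_restr g)).
have hl : linear (fun x => s (f x) : M).
  move=> y u v; have [c ->] := L_scalar y.
  by rewrite linearP; apply: (linearP s).
exists (linear_of hl) => x /=; have [y yx] := gs (f x).
by rewrite -yx; apply: sP.
Qed.

Lemma scalar_gldim : gldim_le L 0.
Proof. by move=> M _; apply/projective_pd0/scalar_projective. Qed.
End OneVertex.

Lemma linear_quiver1_scalar (K : fieldType) (x : path_algebra K (linear_quiver 1)) :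
  exists c : K, x = c *: 1.
Proof.
pose v : vertex (linear_quiver 1) := ord0 : 'I_1.
exists x@_(trivial_path v); apply/malgP => q.
have -> : q = trivial_path v.
  by case: q => -[u [|[]//]] uP; apply: val_inj; rewrite /= [u]ord1.
by rewrite mcoeffZ coef1_trivial mulr1.
Qed.

(** * Conclusion in the cyclic and linear cases *)

Section Nakayama.
Variables (K : fieldType) (L : algType K) (d : nat) (Q : quiver) (U : unrolling Q).
Variables (J : path_algebra K Q -> Prop) (F : {lrmorphism path_algebra K Q -> L}).
Hypotheses (admJ : admissible J) (F_surj : forall y, exists x, F x = y)
  (F_ker : forall x, F x = 0 <-> J x) (gd : gldim_le L d) (d_ge2 : (2 <= d)%N)
  (C : rmodType L -> Prop) (ctC : cluster_tilting d C).

Let D := unrolled_data U admJ F_surj F_ker.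
Local Notation p := (loewy_end U admJ).

Let pdA a b : (a <= b <= p a)%N -> (syz p a b d < syz p a b d.+1)%N ->
  ~~ (syz p a b d.+1 < syz p a b d.+2)%N.
Proof. exact: (@gldim_syz _ _ D). Qed.

Let extB a b i :
  [&& (a < b)%N, (b <= p a)%N & if a is a'.+1 then (p a' < b)%N else un_per U == 0%N] ->
  (i.+1 < d)%N -> (syz p a b i < syz p a b i.+1 < syz p a b i.+2)%N ->
  (p (syz p a b i) < p (syz p a b i).+1)%N.
Proof. exact: (@ct_syz _ _ D d C gd ctC). Qed.

Lemma nakayama_aperiodic : (forall i, un_ok U i) -> (0 < un_per U)%N -> False.
Proof.
move=> okT per0.
apply: (periodic_absurd (@loewy_end_mono _ _ U _ admJ) d_ge2 pdA extB per0) => u.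
  exact: loewy_end_per.
exact: loewy_end_ge2.
Qed.

Variable m : nat.
Hypotheses (perE : un_per U = 0%N) (okE : un_ok U = [pred w | (w < m)%N])
  (m_ge2 : (2 <= m)%N).

Let p_le u : (u <= m)%N -> (p u <= m)%N.
Proof. by move=> um; apply: loewy_end_le => //; rewrite /stop okE /= ltnn. Qed.

Let p_out u : (m <= u)%N -> p u = u.
Proof. by move=> mu; apply: loewy_end_out; rewrite okE /= -leqNgt. Qed.

Let p_ge2 u : (u.+1 < m)%N -> (u.+2 <= p u)%N.
Proof. by move=> um; apply: loewy_end_ge2; rewrite okE. Qed.

Let start : un_per U == 0%N. Proof. by rewrite perE. Qed.

Lemma linear_m_ge3 : (3 <= m)%N.
Proof. exact: (m_ge3 (@loewy_end_mono _ _ U _ admJ) d_ge2 extB m_ge2 start p_le p_ge2). Qed.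

Lemma linear_loewy_end u : (u < m)%N -> p u = minn (u + p 0%N) m.
Proof.
exact: (p_homogeneous (@loewy_end_ge _ _ U _ admJ) (@loewy_end_mono _ _ U _ admJ)
  d_ge2 pdA extB m_ge2 start p_le p_out p_ge2).
Qed.

(** A path of length [k] from [j] ends at [j + k < m]; as [p j = minn (j + p 0) m], it is in [J]
    exactly when [p 0 <= k]. *)
Lemma linear_J x : J x <-> long_paths (p 0%N) x.
Proof.
have idJ : ideal J by case: admJ.
split=> [Jx q xq|/long_pathsP]; last first.
  apply=> // q; have [j j1 qj] := un_cover U (qpath_src q).
  have [w1 ->] := path_is_pth j1 qj; rewrite pth_size ?leq_addr // addKn => lq.
  apply: ge_loewy_end => //; rewrite okE in j1.
  by rewrite linear_loewy_end // geq_min leq_add2l lq.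
have [j j1 qj] := un_cover U (qpath_src q).
have [w1 qE] := path_is_pth j1 qj; rewrite leqNgt; apply: contra xq => lq.
apply/eqP; rewrite qE (J_coef (admJ := admJ) (U := U) Jx) // leq_addr; rewrite okE in j1 w1.
by rewrite linear_loewy_end // leq_min ltn_add2l lq.
Qed.

Lemma linear_no_long_path (x : path_algebra K Q) : long_paths m x -> x = 0.
Proof.
move=> xm; apply/malgP => q; rewrite mcoeff0; apply/eqP; apply: contraT => /xm.
have [j j1 qj] := un_cover U (qpath_src q).
have [w1 _] := path_is_pth j1 qj; move: w1; rewrite okE /= => w1.
by rewrite leqNgt (leq_ltn_trans (leq_addl _ _) w1).
Qed.

Lemma linear_quotient :
  is_quotient (ideal_exp (@jacobson_radical (path_algebra K Q)) (p 0%N)) L.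
Proof.
exists F; split=> // x; rewrite F_ker linear_J ideal_exp_long //.
exact: jacobson_radicalE linear_no_long_path.
Qed.
End Nakayama.

Theorem proposition5p1 (K : fieldType) (L : algType K) (d : nat)
    (nakL : nakayama L) (gldimL : gldim_eq L d) (d_ge2 : (2 <= d)%N)
    (ctL : exists C : rmodType L -> Prop, cluster_tilting d C) :
  exists m l : nat, [/\ (3 <= m)%N, (2 <= l)%N & is_Lambda m l L].
Proof.
have [gd dmin] := gldimL; have [C ctC] := ctL.
case: nakL => [[m m0 [J admJ [F [F_surj F_ker]]]]|[n [J admJ [F [F_surj F_ker]]]]].
  case: m m0 J admJ F F_surj F_ker => [|[|m]] // _ J admJ F F_surj F_ker.
    (* With a single vertex and no arrow [L] consists of scalars, so its global dimension is 0,
       against [2 <= d]. *)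
    suff /dmin d0 : gldim_le L 0 by rewrite leqn0 in d0; rewrite (eqP d0) in d_ge2.
    apply: scalar_gldim => y; have [x <-] := F_surj y.
    have [c ->] := linear_quiver1_scalar x.
    by exists c; rewrite linearZ rmorph1.
  have [U [perE okE]] := linear_unrolling m.
  exists m.+2, (loewy_end U admJ 0); split.
  - exact: (linear_m_ge3 admJ F_surj F_ker gd d_ge2 ctC perE okE isT).
  - by apply: loewy_end_ge2; rewrite okE.
  - exact: (linear_quotient admJ F_surj F_ker gd d_ge2 ctC perE okE isT).
have [U [perE okE]] := cyclic_unrolling n.
by case: (nakayama_aperiodic (U := U) admJ F_surj F_ker gd d_ge2 ctC); rewrite ?okE ?perE.
Qed.
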